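(* Let $k$ be a field and let $A$ be an artinian $k$-algebra with natural valued quiver $((\Delta_0)_A,\mathcal D,\Omega)$ and valued Ext-quiver $(\mathcal Q_A,\mathcal E,\Upsilon)$. Then: (i) The vertex sets are equal: $(\Delta_0)_A=\mathcal Q_A$. (ii) The orientations are the same: $\Omega=\Upsilon$. (iii) The valuations $\mathcal D=\{(d_{ij},d_{ji})\}$ and $\mathcal E=\{(e_{ij},e_{ji})\}$ satisfy, for any vertices $i,j$ joined by an oriented edge $i\to j$, $$d_{ji}=e_{ij}\,n_j^2\,\frac{t_{ij}}{m_{ij}},\qquad d_{ij}=e_{ji}\,n_i^2\,\frac{t_{ij}}{m_{ij}},$$ where $t_{ij}$ is the number of arrows from $i$ to $j$ in the natural quiver $\Delta_A$ of $A$, $m_{ij}$ is the number of arrows from $i$ to $j$ in the natural quiver $\Delta_B$ of the associated basic algebra $B$ of $A$, and $n_i=\dim_kS_i/\dim_k\mathrm{End}\,S_i$ for the simple $A$-module $S_i$ at the vertex $i$.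
   Context: All dimensions over $k$ below are finite. Let $r$ be the radical of $A$ and $A/r=\bigoplus_{i=1}^sA_i$ with $A_i$ the simple two-sided ideals, $A_i\cong M_{n_i}(D_i)$ with $D_i$ division $k$-algebras. Let $T_1,\dots,T_s$ be the corresponding complete set of non-isomorphic simple (left) $A$-modules (also denoted $S_i$), with $D_i\cong\mathrm{End}_A(T_i)$. Vertices are matched by the index $i\in\{1,\dots,s\}$, for $A$ and for its associated basic algebra $B$ (the basic algebra Morita equivalent to $A$). Natural quiver $\Delta_A$: vertices $1,\dots,s$ and $t_{ij}$ arrows from $i$ to $j$, where $t_{ij}$ is the minimal number of generators of $A_i\cdot(r/r^2)\cdot A_j$ as an $A_i$-$A_j$-bimodule. Natural valued quiver of $A$: the induced valued quiver of the associated normal generalized path algebra $k(\Delta_A,\mathcal A)=T(\prod_iA_i,\bigoplus_{i,j}{}_iM_j)$, where ${}_iM_j$ is the free $A_i$-$A_j$-bimodule whose basis is the set of the $t_{ij}$ arrows of $\Delta_A$ from $i$ to $j$. Thus it has vertex set $(\Delta_0)_A=\{1,\dots,s\}$ and a unique oriented edge $i\to j$ when ${}_iM_j\neq0$, with valuation $(d_{ij},d_{ji})$, $d_{ij}=\mathrm{rank}(({}_iM_j)_{A_j})$, $d_{ji}=\mathrm{rank}({}_{A_i}({}_iM_j))$ (rank = minimal number of generators). Valued Ext-quiver of $A$: vertex set $\mathcal Q_A=\{1,\dots,s\}$; an oriented edge $i\to j$ if $\mathrm{Ext}^1_A(T_j,T_i)\ne0$, with valuation $(e_{ij},e_{ji})$,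 $e_{ij}=\dim_{D_i}\mathrm{Ext}^1_A(T_j,T_i)$, $e_{ji}=\dim_{D_j^{op}}\mathrm{Ext}^1_A(T_j,T_i)$. Set-up for basic algebras: for the basic algebra $B$ with radical $r_B$ and $B/r_B\cong F_1\oplus\cdots\oplus F_s$ ($F_i\cong\mathrm{End}(S_i)$ division algebras), the $F_i$-$F_j$-bimodule $F_i(r_B/r_B^2)F_j$ is identified with the free $F_i$-$F_j$-bimodule of rank $m_{ij}$ appearing in the generalized path algebra of $\Delta_B$, so $m_{ij}=\dim_{F_j^{op}\otimes F_i}F_i(r_B/r_B^2)F_j$. *)

(* Defs.v *)
From HB Require Import structures.
From mathcomp Require Export all_boot all_order all_algebra all_field.
From mathcomp Require Export boolp classical_sets functions.

Set Implicit Arguments.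
Unset Strict Implicit.
Unset Printing Implicit Defensive.

Import GRing.Theory passmx.
Local Open Scope ring_scope.

(* The least element of P, and 0 if P is empty. *)
Definition least (P : nat -> Prop) : nat :=
  xget 0%N [set n : nat | P n /\ forall m, P m -> (n <= m)%N]%classic.

(* The vector space is Z / W, for additive subgroups W <= Z of U, over the
   division ring D; [act c u v] means that v represents c.u modulo W (the
   representative need not be unique).  The scalars may act on either side. *)
Section Dimension.
Variables (U : zmodType) (Z W : U -> Prop).
Variables (D : Type) (act : D -> U -> U -> Prop).

Definition is_basis_mod (n : nat) (b : 'I_n -> U) : Prop :=
  (forall l, Z (b l)) /\
  (forall z, Z z -> exists! c : 'I_n -> D, exists w : 'I_n -> U,
     (forall l, act (c l) (b l) (w l)) /\ W (z - \sum_(l < n) w l)).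

Definition dimension : nat :=
  least (fun n => exists b : 'I_n -> U, is_basis_mod b).
End Dimension.

Section Modules.
Variables (k : fieldType) (A : falgType k).

Definition simple_mod (M : lmodType A) : Prop :=
  (exists x : M, x != 0) /\
  forall S : {pred M}, submod_closed S -> S =i pred1 0 \/ S =i predT.

Definition mod_iso (M N : lmodType A) : Prop :=
  exists f : {linear M -> N}, bijective f.

Definition dim_mod (M : lmodType A) : nat :=
  @dimension M (fun=> True) (fun x => x = 0) k
    (fun c x y => y = c%:A *: x).

Definition dim_End (M : lmodType A) : nat :=
  @dimension (M -> M) (fun f => linear f) (fun f => f = 0) k
    (fun c f g => forall x, g x = c%:A *: f x).

Definition projective (P : lmodType A) : Prop :=
  forall (M N : lmodType A) (p : {linear M -> N}) (f : {linear P -> N}),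
    (forall y, exists x, p x = y) ->
    exists g : {linear P -> M}, forall x, p (g x) = f x.

Record proj_resolution (M : lmodType A) := ProjResolution {
  res_mod : nat -> lmodType A;
  res_diff : forall n, {linear res_mod n.+1 -> res_mod n};
  res_aug : {linear res_mod 0%N -> M};
  res_projective : forall n, projective (res_mod n);
  res_exact : forall n (x : res_mod n.+1),
    res_diff n x = 0 <-> exists y, x = res_diff n.+1 y;
  res_exact0 : forall x : res_mod 0%N,
    res_aug x = 0 <-> exists y, x = res_diff 0%N y;
  res_surj : forall y : M, exists x, res_aug x = y
}.

(* Ext^1_A(M, N) is the group of 1-cocycles modulo the 1-coboundaries of
   Hom_A(P_*, N), for P_* a projective resolution of M. *)
Section Ext1.
Variables (M N : lmodType A) (P : proj_resolution M).

Definition cocycle1 (f : res_mod P 1 -> N) : Prop :=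
  linear f /\ forall x : res_mod P 2, f (res_diff P 1 x) = 0.

Definition coboundary1 (f : res_mod P 1 -> N) : Prop :=
  exists g : {linear res_mod P 0 -> N}, forall x, f x = g (res_diff P 0 x).

Definition Ext1_neq0 : Prop := exists f, cocycle1 f /\ ~ coboundary1 f.

Definition Ext1_lact (d : {linear N -> N}) (f g : res_mod P 1 -> N) : Prop :=
  forall x, g x = d (f x).

(* An endomorphism of M acts through any lift of it to the resolution. *)
Definition Ext1_ract (d : {linear M -> M}) (f g : res_mod P 1 -> N) : Prop :=
  exists (d0 : {linear res_mod P 0 -> res_mod P 0})
         (d1 : {linear res_mod P 1 -> res_mod P 1}),
    [/\ forall x, res_aug P (d0 x) = d (res_aug P x),
        forall x, res_diff P 0 (d1 x) = d0 (res_diff P 0 x)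
      & forall x, g x = f (d1 x)].

Definition dim_Ext1_l : nat := dimension cocycle1 coboundary1 Ext1_lact.
Definition dim_Ext1_r : nat := dimension cocycle1 coboundary1 Ext1_ract.
End Ext1.

End Modules.

Record klin_functor (k : fieldType) (A B : falgType k) := KlinFunctor {
  fobj :> lmodType A -> lmodType B;
  fmap : forall M N : lmodType A,
    {linear M -> N} -> {linear fobj M -> fobj N};
  fmap_id : forall M : lmodType A, fmap (idfun : {linear M -> M}) =1 idfun;
  fmap_comp : forall (L M N : lmodType A)
    (g : {linear M -> N}) (f : {linear L -> M}),
    fmap (g \o f : {linear L -> N}) =1 fmap g \o fmap f;
  fmap_linear : forall (M N : lmodType A) (c : k) (f g h : {linear M -> N}),
    (forall x, h x = c%:A *: f x + g x) ->
    forall y, fmap h y = c%:A *: fmap f y + fmap g y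
}.

(* an isomorphism between the identity functor and G \o F *)
Record unit_iso (k : fieldType) (A B : falgType k)
    (F : klin_functor A B) (G : klin_functor B A) := UnitIso {
  unit_map : forall M : lmodType A, {linear M -> G (F M)};
  unit_bij : forall M, bijective (unit_map M);
  unit_nat : forall (M N : lmodType A) (f : {linear M -> N}) (x : M),
    unit_map N (f x) = fmap G (fmap F f) (unit_map M x)
}.

Record morita_equiv (k : fieldType) (A B : falgType k) := MoritaEquiv {
  morita_fun :> klin_functor A B;
  morita_inv : klin_functor B A;
  morita_unit : unit_iso morita_fun morita_inv;
  morita_counit : unit_iso morita_inv morita_fun
}.

Section Ideals.
Variables (k : fieldType) (A : falgType k).
Implicit Types I J : {vspace A}.

Definition left_ideal I : bool := (fullv * I <= I)%VS.
Definition two_sided_ideal I : bool :=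
  (fullv * I <= I)%VS && (I * fullv <= I)%VS.

Definition maximal_left_ideal I : Prop :=
  [/\ left_ideal I, I != fullv &
      forall J, left_ideal J -> (I <= J)%VS -> J = I \/ J = fullv].

Definition simple_ideal I : Prop :=
  [/\ two_sided_ideal I, I != 0%VS &
      forall J, two_sided_ideal J -> (J <= I)%VS -> J = 0%VS \/ J = I].

Definition is_radical (r : {vspace A}) : Prop :=
  forall x : A, x \in r <-> forall I, maximal_left_ideal I -> x \in I.
End Ideals.

(* [top_dec A s] : the radical r of A, the quotient A / r (as a surjective
   algebra morphism with kernel r) and the list, without repetition, of the s
   simple two-sided ideals of A / r.  These ideals are algebras for their own
   identity element, which is why they are taken in {aspace _}. *)
Record top_dec (k : fieldType) (A : falgType k) (s : nat) := TopDec {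
  rad : {vspace A};
  rad_radical : is_radical rad;
  top : falgType k;
  topi : 'AHom(A, top);
  topi_ker : lker topi = rad;
  topi_surj : limg topi = fullv;
  blk : 'I_s -> {aspace top};
  blk_inj : injective blk;
  blk_simple : forall i, simple_ideal (blk i);
  blk_all : forall I : {vspace top}, simple_ideal I ->
    exists i, I = blk i :> {vspace top}
}.

(* Free R-S-bimodule (over k) with basis 'I_t, i.e. t copies of R (x)_k S.  A
   tensor is the matrix of its coordinates in the bases of R and S: by
   [tens_vbasis] the products of basis vectors are the matrix units, and
   [tensor_act] gives the two actions on pure tensors. *)
Section FreeBimodule.
Variables (k : fieldType) (R S : falgType k).

Definition tensor := 'M[k]_(\dim {:R}, \dim {:S}).

Definition tens (x : R) (y : S) : tensor :=
  (rVof (vbasis {:R}) x)^T *m rVof (vbasis {:S}) y.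

Definition tensor_lact (a : R) (z : tensor) : tensor :=
  (mxof (vbasis {:R}) (vbasis {:R}) (amull a))^T *m z.
Definition tensor_ract (z : tensor) (b : S) : tensor :=
  z *m mxof (vbasis {:S}) (vbasis {:S}) (amulr b).

Lemma tens_vbasis (p : 'I_(\dim {:R})) (q : 'I_(\dim {:S})) :
  tens (vbasis {:R})`_p (vbasis {:S})`_q = delta_mx p q.
Proof. by rewrite /tens !rVofE ?vbasisP // trmx_delta mul_delta_mx. Qed.

Lemma tensor_act (a x : R) (y b : S) :
  tensor_lact a (tensor_ract (tens x y) b) = tens (a * x) (y * b).
Proof.
rewrite /tensor_lact /tensor_ract /tens -mulmxA mul_rV_lin1 mulmxA -trmx_mul.
by rewrite mul_rV_lin1 /= !rVofK ?vbasisP // !lfunE.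
Qed.

Definition free_bimod (t : nat) := {ffun 'I_t -> 'M[k]_(\dim {:R}, \dim {:S})}.

Variable t : nat.

Definition free_lact (a : R) (z : free_bimod t) : free_bimod t :=
  [ffun l => tensor_lact a (z l)].
Definition free_ract (z : free_bimod t) (b : S) : free_bimod t :=
  [ffun l => tensor_ract (z l) b].

(* minimal number of generators as a left R-module, as a right S-module *)
Definition free_rank_l : nat := least (fun n =>
  exists y : 'I_n -> free_bimod t, forall z : free_bimod t,
  exists c : 'I_n -> R, z = \sum_(l < n) free_lact (c l) (y l)).
Definition free_rank_r : nat := least (fun n =>
  exists y : 'I_n -> free_bimod t, forall z : free_bimod t,
  exists c : 'I_n -> S, z = \sum_(l < n) free_ract (y l) (c l)).
End FreeBimodule.

Section NaturalQuiver.
Variables (k : fieldType) (A : falgType k) (s : nat) (W : top_dec A s).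
Implicit Types i j : 'I_s.
Local Notation r := (rad W).

Definition blk_pre i : {vspace A} := (topi W @^-1: blk W i)%VS.

(* The submodules of r / r^2 are written as subspaces of r containing r^2:
   [layer i j] is the inverse image in r of A_i.(r / r^2).A_j. *)
Definition layer i j : {vspace A} :=
  (blk_pre i * r * blk_pre j + r * r)%VS.

(* number t_ij of arrows i -> j of the natural quiver: the minimal number of
   generators of A_i.(r / r^2).A_j as an A_i-A_j-bimodule *)
Definition arrows i j : nat := least (fun n =>
  exists x : 'I_n -> A, (forall l, x l \in layer i j) /\
  (\sum_(l < n) blk_pre i * <[x l]> * blk_pre j + r * r)%VS = layer i j).

(* A_i.(r / r^2).A_j is isomorphic to the free A_i-A_j-bimodule of rank m *)
Definition layer_free i j (m : nat) : Prop :=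
  exists phi : 'Hom(A, free_bimod (subvs_of (blk W i)) (subvs_of (blk W j)) m),
  [/\ (phi @: layer i j = fullv)%VS,
      (layer i j :&: lker phi = r * r)%VS &
      forall (u : subvs_of (blk W i)) (v : subvs_of (blk W j)) (a x b : A),
        topi W a = vsval u -> topi W b = vsval v -> x \in layer i j ->
        phi (a * x * b) = free_lact u (free_ract (phi x) v)].

Definition basic_alg : Prop :=
  forall i (x : subvs_of (blk W i)), x != 0 -> x \is a GRing.unit.

Definition simple_at i (T : lmodType A) : Prop :=
  simple_mod T /\ exists a x, a \in blk_pre i /\ a *: (x : T) != 0.

Definition bimod_of_arrows i j :=
  free_bimod (subvs_of (blk W i)) (subvs_of (blk W j)) (arrows i j).

End NaturalQuiver.

(* The valuation is only meaningful on the oriented edges. *)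
Record valued_quiver := ValuedQuiver {
  vertex : finType;
  edge : vertex -> vertex -> Prop;
  valuation : vertex -> vertex -> nat * nat
}.

(* On an edge i -> j, the valuation is (d_ij, d_ji). *)
Definition natural_valued_quiver (k : fieldType) (A : falgType k) (s : nat)
    (W : top_dec A s) : valued_quiver :=
  @ValuedQuiver 'I_s
    (fun i j => exists z : bimod_of_arrows W i j, z != 0)
    (fun i j =>
       (free_rank_r (subvs_of (blk W i)) (subvs_of (blk W j)) (arrows W i j),
        free_rank_l (subvs_of (blk W i)) (subvs_of (blk W j)) (arrows W i j))).

(* On an edge i -> j, the valuation is (e_ij, e_ji): the dimensions of
   Ext^1(T_j, T_i) over End(T_i) and over End(T_j)^op. *)
Definition valued_Ext_quiver (k : fieldType) (A : falgType k) (s : nat)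
    (T : 'I_s -> lmodType A) (P : forall j, proj_resolution (T j)) :
    valued_quiver :=
  @ValuedQuiver 'I_s
    (fun i j => Ext1_neq0 (T i) (P j))
    (fun i j => (dim_Ext1_l (T i) (P j), dim_Ext1_r (T i) (P j))).

(* Main.v *)
(** Write Ext^1(M, N) as Hom(K, N) modulo Hom(Q, N) for any map from Q onto M with
    kernel K.  Two such presentations with comparison maps in both directions
    give the same group, so the one coming from P_0 -> T_j over A can be replaced,
    through the equivalence, by B -> S_j over B.

    For an algebra A and simple modules T_j, T_i, restriction to the radical r
    embeds Hom(ann x, T_i) modulo the maps a |-> a.y into the left linear maps
    from A_i.(r/r^2).A_j to T_i.  This gives (ii), and when B is basic and
    F_i.(r/r^2).F_j is free of rank m, an isomorphism of Ext^1 with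
    Hom_k(F_j, F_i)^m.  Hence e_ij = m dim_k F_j and e_ji = m dim_k F_i.  On the
    other side d_ji = t_ij dim_k A_j and d_ij = t_ij dim_k A_i, and the formulas
    follow from dim_k A_i . dim_k End(T_i) = (dim_k T_i)^2. *)

From HB Require Import structures.
From mathcomp Require Import all_boot all_order all_algebra all_field ring.
Require Import Defs.

Set Implicit Arguments.
Unset Strict Implicit.
Unset Printing Implicit Defensive.
Import GRing.Theory.
Local Open Scope ring_scope.

(** * Dimensions over division algebras *)

(** The resolution of T_j is arbitrary and lives over A, while freeness is known over B only. Hence
    Ext^1 is compared with a presentation whose kernel is a concrete left ideal, the annihilator of
    a nonzero element. Quotients are handled by representatives: maps on the whole algebra whose
    values matter only on an annihilator or on a layer, up to coboundaries.

    Dimensions over division algebras are obtained by counting over k: the dimension of Z / W over D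
    is its dimension over k divided by that of D.

    The factor t/m arises because Ext^1 is counted by the arrows of B and the valuation by those of
    A. The equivalence gives dim_k F_j = dim_k End(T_j), so n_j^2 dim_k F_j = dim_k A_j, and d_ji =
    t_ij n_j^2 dim_k F_j = (t_ij / m_ij) n_j^2 e_ij; the other formula is symmetric. That m_ij is
    nonzero follows from the edge: a nonzero Ext^1 over A is carried to B and forces a nonzero layer
    there. *)

Lemma leastP (P : nat -> Prop) (n : nat) :
  P n -> P (least P) /\ forall m, P m -> (least P <= m)%N.
Proof.
move=> Pn; rewrite /least; case: xgetP => [m _ [Pm le_m] // | no].
have exP : exists m, `[< P m >] by exists n; apply/asboolP.
case: (ex_minnP exP) => m /asboolP Pm le_m; case: (no m); split=> // p Pp.
by apply: le_m; apply/asboolP.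
Qed.

Lemma least_eq (P : nat -> Prop) (n : nat) :
  P n -> (forall m, P m -> (n <= m)%N) -> least P = n.
Proof.
move=> Pn le_n; have [Pl /(_ n Pn) le_l] := leastP Pn.
by apply/eqP; rewrite eqn_leq le_l le_n.
Qed.

(** A subspace of largest dimension inside [S] exhausts it, since adjoining the line of a missed
    vector would enlarge it. Annihilators and generated ideals, given by propositions, become
    subspaces this way. *)
Lemma vspace_of_pred (k : fieldType) (V : vectType k) (S : V -> Prop) :
  S 0 -> (forall (c : k) x y, S x -> S y -> S (c *: x + y)) ->
  exists U : {vspace V}, forall x, x \in U <-> S x.
Proof.
move=> S0 SL.
pose P d := exists U : {vspace V}, (forall x, x \in U -> S x) /\ \dim U = d.
have exP : exists d, `[< P d >].
  exists 0%N; apply/asboolP; exists 0%VS; split; last by rewrite dimv0.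
  by move=> x; rewrite memv0 => /eqP->.
have ubP d : `[< P d >] -> (d <= \dim (fullv : {vspace V}))%N.
  by case/asboolP=> U [_ <-]; apply/dimvS/subvf.
case: (ex_maxnP exP ubP) => d /asboolP[U [SU dU]] maxd.
exists U => x; split=> [/SU // | Sx].
have : (U <= U + <[x]>)%VS by apply: addvSl.
move/dimv_leqif_eq => [_].
rewrite eqn_leq dimvS ?addvSl //= dU maxd.
  move/esym/eqP->; exact/(subvP (addvSr _ _))/memv_line.
apply/asboolP; exists (U + <[x]>)%VS; split=> // _ /memv_addP[u uU [_ /vlineP[c ->] ->]].
by rewrite addrC; apply: SL => //; apply: SU.
Qed.

Definition lin (R : pzRingType) (M N : lmodType R) (f : M -> N)
  (fL : linear f) : {linear M -> N} :=
  HB.pack f (GRing.isLinear.Build R M N *:%R f fL).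

Lemma lin_scale (R : pzRingType) (M N : lmodType R) (f : M -> N) :
  linear f -> forall a x, f (a *: x) = a *: f x.
Proof. by move=> fL; apply: (linearZ_LR (lin fL)). Qed.

Lemma lin_subr (R : pzRingType) (M N : lmodType R) (f g : M -> N) :
  linear f -> linear g -> linear (f - g).
Proof. by move=> fL gL a u v; rewrite [LHS](linearP (lin fL \- lin gL)). Qed.

Lemma linear_ext (R : pzRingType) (M N : lmodType R) (f g : {linear M -> N}) :
  f =1 g -> f = g.
Proof.
case: f g => [f [[fa] [fs]]] [g [[ga] [gs]]] /= /funext fg; subst g.
by rewrite (Prop_irrelevance fa ga) (Prop_irrelevance fs gs).
Qed.

Section Kernel.
Variables (R : pzRingType) (M N : lmodType R) (f : {linear M -> N}).

Definition kernel_pred : {pred M} := [pred x | f x == 0].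

Lemma kernel_submod : subsemimod_closed kernel_pred.
Proof.
split; first split; first by rewrite inE linear0.
  by move=> x y; rewrite !inE linearD => /eqP-> /eqP->; rewrite addr0.
by move=> a x; rewrite !inE linearZ /= => /eqP->; rewrite scaler0.
Qed.

(** A functor applies only to objects of type [lmodType], so the kernel is packaged as a module of
    its own. *)
Record kernel := Kernel { kernel_val : M; kernelP : kernel_val \in kernel_pred }.
HB.instance Definition _ := [isSub for kernel_val].
HB.instance Definition _ := [Choice of kernel by <:].
HB.instance Definition _ :=
  GRing.SubChoice_isSubLmodule.Build R M kernel_pred kernel kernel_submod.

Definition kernel_incl : {linear kernel -> M} := val.

Lemma kernel_incl0 x : f (kernel_incl x) = 0.
Proof. by case: x => x /= /eqP. Qed.

Lemma kernel_lift (L : lmodType R) (g : {linear L -> M}) :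
  (forall x, f (g x) = 0) ->
  exists h : {linear L -> kernel}, forall x, kernel_incl (h x) = g x.
Proof.
move=> fg0; have fg x : g x \in kernel_pred by rewrite inE fg0.
have hL : linear (fun x => Kernel (fg x)).
  by move=> a x y; apply: val_inj; rewrite /= linearP.
by exists (lin hL).
Qed.
End Kernel.

Section FreeModule.
Variables (k : fieldType) (E V : vectType k).

Lemma ffun_dim n : \dim {: {ffun 'I_n -> E}} = (n * \dim {:E})%N.
Proof. by rewrite !dimvf /dim /= card_ord. Qed.

Section Family.
Variables (n : nat) (f : 'I_n -> E -> V).
Hypothesis fL : forall l, linear (f l).

Let phi (c : {ffun 'I_n -> E}) : V := \sum_l f l (c l).
Let phiL : linear phi.
Proof.
move=> a c d; rewrite /phi scaler_sumr -big_split /=; apply: eq_bigr => l _.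
by rewrite !ffunE fL.
Qed.

Lemma free_family_dim :
  (forall c : 'I_n -> E, \sum_l f l (c l) = 0 -> forall l, c l = 0) ->
  (n * \dim {:E} <= \dim {:V})%N.
Proof.
move=> inj; rewrite -ffun_dim -(@limg_dim_eq _ _ _ (linfun (lin phiL)) fullv).
  exact/dimvS/subvf.
apply/eqP; rewrite capfv -subv0; apply/subvP=> c; rewrite memv_ker lfunE /=.
by move/eqP/inj=> c0; rewrite memv0; apply/eqP/ffunP=> l; rewrite c0 ffunE.
Qed.

Lemma span_family_dim :
  (forall v, exists c : 'I_n -> E, v = \sum_l f l (c l)) ->
  (\dim {:V} <= n * \dim {:E})%N.
Proof.
move=> gen; rewrite -ffun_dim -(limg_ker_dim (linfun (lin phiL)) fullv).
apply: leq_trans (leq_addl _ _).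
apply/dimvS/subvP=> v _; have [c ->] := gen v.
have -> : \sum_l f l (c l) = linfun (lin phiL) [ffun l => c l].
  by rewrite lfunE; apply: eq_bigr => l _; rewrite ffunE.
exact/memv_img/memvf.
Qed.

Lemma basis_family_dim :
  (forall v, exists! c : 'I_n -> E, v = \sum_l f l (c l)) ->
  \dim {:V} = (n * \dim {:E})%N.
Proof.
move=> bas; apply/eqP; rewrite eqn_leq free_family_dim ?andbT; last first.
  move=> c c0 l; have [d [_ du]] := bas 0.
  rewrite -[c](du c) // (du (fun=> 0)) // big1 // => i _.
  exact: (linear0 (lin (fL i))).
by apply: span_family_dim => v; have [c [-> _]] := bas v; exists c.
Qed.
End Family.

Variables (act : E -> V -> V) (mul : E -> E -> E).
Hypotheses (E_gt0 : (0 < \dim {:E})%N).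
Hypotheses (actl : forall v, linear (act^~ v)) (actr : forall c, additive (act c)).
Hypothesis actM : forall c d v, act c (act d v) = act (mul c d) v.
Hypothesis actV : forall c, c != 0 -> exists d, forall v, act d (act c v) = v.

(** A maximal independent family spans; its size is bounded by dimensions over [k]. *)
Lemma division_basis :
  exists n (b : 'I_n -> V), forall v, exists! c : 'I_n -> E,
    v = \sum_l act (c l) (b l).
Proof.
pose indep n (b : 'I_n -> V) := forall c : 'I_n -> E,
  \sum_l act (c l) (b l) = 0 -> forall l, c l = 0.
have act0l v : act 0 v = 0 by apply: (linear0 (lin (actl v))).
have actBl c d v : act (c - d) v = act c v - act d v.
  exact: (linearB (lin (actl v))).
have act0r c : act c 0 = 0 by rewrite -{1}(subrr 0) actr subrr.
have actDr c : {morph act c : u v / u + v}.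
  move=> u v; rewrite -{1}[v]opprK -[- v]sub0r actr actr act0r sub0r opprK.
  by [].
have act_sum c n (w : 'I_n -> V) : act c (\sum_l w l) = \sum_l act c (w l).
  by apply: (big_morph _ (actDr c) (act0r c)).
have ex0 : exists n, `[< exists b, @indep n b >].
  by exists 0%N; apply/asboolP; exists (fun=> 0) => c _ [].
have ub n : `[< exists b, @indep n b >] -> (n <= \dim {:V})%N.
  move/asboolP=> [b bi]; apply: leq_trans (leq_pmulr _ E_gt0) _.
  exact: (@free_family_dim n (fun l c => act c (b l))).
case: (ex_maxnP ex0 ub) => n /asboolP[b bi] maxn; exists n, b => v.
suff [c vE] : exists c : 'I_n -> E, v = \sum_l act (c l) (b l).
  exists c; split=> // d vE'; apply/funext=> l; apply/eqP; rewrite -subr_eq0.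
  apply/eqP; apply: (bi (fun l => c l - d l)); under eq_bigr do rewrite actBl.
  by rewrite big_split sumrN /= -vE -vE' subrr.
have [//|nv] := EM (exists c : 'I_n -> E, v = \sum_l act (c l) (b l)).
suff : (n.+1 <= n)%N by rewrite ltnn.
apply: maxn; apply/asboolP.
(* The vector [v] outside the span is adjoined at the last index. In a relation its coefficient is
   zero, or else invertible, which puts [v] in the span. *)
exists (fun l : 'I_n.+1 => oapp b v (unlift ord_max l)) => c.
have wl (l : 'I_n) : widen_ord (leqnSn n) l = lift ord_max l.
  by apply: val_inj; rewrite /= /bump leqNgt ltn_ord.
rewrite big_ord_recr /= unlift_none /=.
under eq_bigr do rewrite wl liftK /=.
have [cm|/actV[d dK]] := eqVneq (c ord_max) 0.
  rewrite cm act0l addr0 => /bi c0 l; have [j ->|->//] := unliftP ord_max l.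
  exact: c0.
move=> sum0; case: nv; exists (fun l => mul d (- c (lift ord_max l))).
move/eqP: sum0; rewrite addrC addr_eq0 => /eqP cv.
rewrite -[LHS]dK cv -sub0r actr act0r sub0r act_sum -sumrN.
apply: eq_bigr => l _; rewrite -actM -[in RHS]sub0r actBl act0l sub0r.
by rewrite -[in RHS]sub0r actr act0r sub0r.
Qed.

(* [Phi] identifies Z / W with [V] and [delta] identifies the scalars with [E];
   [mul] may be the opposite product, so that right actions are covered. *)
Variables (U : zmodType) (Z W : U -> Prop) (D : Type) (dact : D -> U -> U -> Prop).
Variables (Phi : U -> V) (delta : D -> E).
Hypotheses (ZB : forall x y, Z x -> Z y -> Z (x - y)).
Hypothesis PhiB : forall x y, Z x -> Z y -> Phi (x - y) = Phi x - Phi y.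
Hypothesis Phi_onto : forall v, exists x, Z x /\ Phi x = v.
Hypothesis Phi_ker : forall x, Z x -> (W x <-> Phi x = 0).
Hypothesis dact_ex : forall c x, Z x -> exists y, dact c x y.
Hypothesis dactP : forall c x y,
  Z x -> dact c x y -> Z y /\ Phi y = act (delta c) (Phi x).
Hypothesis delta_bij : bijective delta.

(** [Phi] turns bases modulo [W] into families of [V] with unique coordinates in [E]. These exist by
    [division_basis], and a count over [k] shows that they all have the same size, so [least] picks
    it. *)
Lemma dimensionE : (dimension Z W dact * \dim {:E})%N = \dim {:V}.
Proof.
have [delta' dK dK'] := delta_bij.
have Z0 : Z 0 by have [x [Zx _]] := Phi_onto 0; rewrite -(subrr x); apply: ZB.
have Phi0 : Phi 0 = 0 by rewrite -(subrr 0) PhiB // subrr.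
have ZD x y : Z x -> Z y -> Z (x + y).
  by move=> Zx Zy; rewrite -[y]opprK -[- y]sub0r; apply/ZB/ZB.
have PhiD x y : Z x -> Z y -> Phi (x + y) = Phi x + Phi y.
  move=> Zx Zy; rewrite -{1}[y]opprK -[- y]sub0r PhiB //; last exact: ZB.
  by rewrite PhiB // Phi0 sub0r opprK.
have Zsum n (w : 'I_n -> U) : (forall l, Z (w l)) ->
    Z (\sum_l w l) /\ Phi (\sum_l w l) = \sum_l Phi (w l).
  move=> Zw; apply: (big_ind2 (fun x y => Z x /\ Phi x = y)) => //.
  by move=> x _ y _ [Zx <-] [Zy <-]; split; [apply: ZD | rewrite PhiD].
(* The representatives [w l] are ambiguous, but [dactP] determines their images under [Phi]. *)
have combP n (b : 'I_n -> U) z c : (forall l, Z (b l)) -> Z z ->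
    (exists w, (forall l, dact (c l) (b l) (w l)) /\ W (z - \sum_(l < n) w l)) <->
    Phi z = \sum_l act (delta (c l)) (Phi (b l)).
  move=> Zb Zz; split.
    case=> w [cw]; have Zw l := dactP (Zb l) (cw l).
    have [Zs Ps] := Zsum n w (fun l => proj1 (Zw l)).
    move=> /Phi_ker-/(_ (ZB Zz Zs)) /eqP; rewrite PhiB // subr_eq0 => /eqP->.
    by rewrite Ps; apply: eq_bigr => l _; apply: (proj2 (Zw l)).
  move=> PzE; have /choice[w cw] l := dact_ex (c l) (Zb l).
  have Zw l := dactP (Zb l) (cw l).
  have [Zs Ps] := Zsum n w (fun l => proj1 (Zw l)).
  exists w; split=> //; apply/Phi_ker; first exact: ZB.
  apply/eqP; rewrite PhiB // subr_eq0 PzE Ps; apply/eqP/eq_bigr=> l _.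
  by rewrite (proj2 (Zw l)).
have basisP n (b : 'I_n -> U) : (forall l, Z (b l)) ->
    is_basis_mod Z W dact b <->
    (forall v, exists! c : 'I_n -> E, v = \sum_l act (c l) (Phi (b l))).
  move=> Zb; split.
    case=> _ bas v; have [z [Zz <-]] := Phi_onto v.
    have [c [/combP cz cu]] := bas z Zz; exists (delta \o c); split.
      exact: cz.
    move=> d zE; rewrite (cu (delta' \o d)); first by apply/funext=> l /=.
    by apply/combP => //; rewrite zE; apply: eq_bigr => l _ /=; rewrite dK'.
  move=> bas; split=> // z Zz; have [c [zE cu]] := bas (Phi z).
  exists (delta' \o c); split.
    by apply/combP => //; rewrite zE; apply: eq_bigr => l _ /=; rewrite dK'.
  move=> d /combP-/(_ Zb Zz) zE'; apply/funext=> l /=.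
  by rewrite (cu (delta \o d) zE') /= dK.
pose P n := exists b : 'I_n -> U, is_basis_mod Z W dact b.
have dimP n : P n -> (n * \dim {:E})%N = \dim {:V}.
  case=> b bas; have /basisP-/(_ (proj1 bas)) := bas.
  by move/(@basis_family_dim n (fun l c => act c (Phi (b l)))) => ->.
suff [n Pn] : exists n, P n by apply: dimP; have [] := leastP Pn.
have [n [v bas]] := division_basis.
have /choice[b bP] l := Phi_onto (v l); exists n, b; apply/basisP.
  by move=> l; have [] := bP l.
have vE : v = (fun l => Phi (b l)) by apply/funext=> l; have [] := bP l.
by rewrite vE in bas.
Qed.
End FreeModule.

(** * Simple ideals and primitive idempotents *)

Lemma left_idealP (k : fieldType) (A : falgType k) (I : {vspace A}) :
  left_ideal I <-> forall a x, x \in I -> a * x \in I.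
Proof.
split=> [/prodvP II a x|II]; first exact/II/memvf.
by apply/prodvP=> a x _; apply: II.
Qed.

Lemma two_sided_idealP (k : fieldType) (A : falgType k) (I : {vspace A}) :
  two_sided_ideal I <-> forall a x, x \in I -> a * x \in I /\ x * a \in I.
Proof.
split=> [/andP[/prodvP lI /prodvP rI] a x xI | II].
  by split; [apply/lI/xI/memvf | apply/rI/memvf].
by apply/andP; split; apply/prodvP=> x y; [move=> _ /II | move=> /II xI _];
  [move=> yI; case: (yI x) | case: (xI y)].
Qed.

Lemma linear_algZ (k : fieldType) (A : falgType k) (M N : lmodType A)
  (f : {linear M -> N}) (c : k) x : f (c%:A *: x) = c%:A *: f x.
Proof. by rewrite linearZ. Qed.

Lemma simple_gen (k : fieldType) (A : falgType k) (M : lmodType A) (x : M) :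
  simple_mod M -> x != 0 -> forall y, exists a : A, y = a *: x.
Proof.
move=> [_ simM] nzx y.
pose S : {pred M} := [pred y | `[< exists a : A, y = a *: x >]].
have /simM[S0|ST] : submod_closed S.
- split; first by apply/asboolP; exists 0; rewrite scale0r.
  move=> a u v /asboolP[b ->] /asboolP[c ->]; apply/asboolP.
  by exists (a * b + c); rewrite scalerDl scalerA.
- have : x \in S by apply/asboolP; exists 1; rewrite scale1r.
  by rewrite S0 inE (negPf nzx).
by have /asboolP : y \in S by rewrite ST.
Qed.

Lemma simple_onto (k : fieldType) (A : falgType k) (M N : lmodType A)
    (f : {linear M -> N}) :
  simple_mod N -> (exists x, f x != 0) -> forall y, exists x, f x = y.
Proof.
move=> simN [x /(simple_gen simN) gen] y; have [a ->] := gen y.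
by exists (a *: x); rewrite linearZ.
Qed.

Lemma simple_inj (k : fieldType) (A : falgType k) (M N : lmodType A)
    (f : {linear M -> N}) :
  simple_mod M -> (exists x, f x != 0) -> injective f.
Proof.
move=> simM [x0 nz] x y fxy; apply/eqP; rewrite -subr_eq0; apply/eqP.
have [//|/(simple_gen simM)/(_ x0)[a x0E]] := eqVneq (x - y) 0.
by move: nz; rewrite x0E linearZ linearB /= fxy subrr scaler0 eqxx.
Qed.

Lemma simple_mod_iso (k : fieldType) (A : falgType k) (M N : lmodType A) :
  simple_mod M -> simple_mod N ->
  (exists f : {linear M -> N}, exists x, f x != 0) -> mod_iso M N.
Proof.
move=> simM simN [f nz]; exists f.
have /choice[g gK] := simple_onto simN nz.
by exists g => // x; apply: (simple_inj simM nz); rewrite gK.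
Qed.

Section Structure.
Variables (k : fieldType) (A : falgType k) (s : nat) (W : top_dec A s).
Implicit Types (i j : 'I_s) (M : lmodType A).
Local Notation r := (rad W).
Local Notation pi := (topi W).
(** The unit of A_i as an algebra is, inside A / r, the central idempotent that cuts out A_i. *)
Definition blk1 i : top W := algid (blk W i).

Lemma topiM a b : pi (a * b) = pi a * pi b.
Proof. exact: rmorphM. Qed.

Lemma topi1 : pi 1 = 1.
Proof. exact: rmorph1. Qed.

Lemma mem_rad x : (x \in r) = (pi x == 0).
Proof. by rewrite -topi_ker memv_ker. Qed.

Lemma rad_mull a x : x \in r -> a * x \in r.
Proof. by rewrite !mem_rad topiM => /eqP->; rewrite mulr0. Qed.

Lemma rad_mulr a x : x \in r -> x * a \in r.
Proof. by rewrite !mem_rad topiM => /eqP->; rewrite mul0r. Qed.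

Lemma topi_ex (t : top W) : exists a, pi a = t.
Proof.
by have := memvf t; rewrite -(topi_surj W) => /memv_imgP[a _ ->]; exists a.
Qed.

Lemma mem_blk_pre i a : (a \in blk_pre W i) = (pi a \in blk W i).
Proof. by rewrite -memv_preim. Qed.

Lemma blk_mul i a x : x \in blk W i -> a * x \in blk W i /\ x * a \in blk W i.
Proof. by have [/two_sided_idealP II _ _] := blk_simple W i; apply: II. Qed.

Lemma blk1_in i : blk1 i \in blk W i.
Proof. exact: memv_algid. Qed.

Lemma blk1_neq0 i : blk1 i != 0.
Proof. exact: algid_neq0. Qed.

Lemma blk1l i x : x \in blk W i -> blk1 i * x = x.
Proof. exact: algidl. Qed.

Lemma blk1r i x : x \in blk W i -> x * blk1 i = x.
Proof. exact: algidr. Qed.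

Lemma blk1_comm i t : t * blk1 i = blk1 i * t.
Proof.
have [l rr] := blk_mul t (blk1_in i).
by rewrite -(blk1l l) mulrA blk1r.
Qed.

Lemma blk1_idem i : blk1 i * blk1 i = blk1 i.
Proof. exact/blk1l/blk1_in. Qed.

(** The product lies in the intersection of two different minimal ideals, which is zero. *)
Lemma blk_mul0 i j x y : i != j -> x \in blk W i -> y \in blk W j -> x * y = 0.
Proof.
move=> nij xi yj; pose I := (blk W i :&: blk W j)%VS.
have I2 : two_sided_ideal I.
  apply/two_sided_idealP=> a z /memv_capP[zi zj].
  have [? ?] := blk_mul a zi; have [? ?] := blk_mul a zj.
  by split; apply/memv_capP.
have [_ _ mini] := blk_simple W i; have [_ _ minj] := blk_simple W j.
have : x * y \in I.
  by apply/memv_capP; split; [case: (blk_mul y xi) | case: (blk_mul x yj)].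
have [->|Ii] := mini I I2 (capvSl _ _); first by rewrite memv0 => /eqP.
have [->|Ij] := minj I I2 (capvSr _ _); first by rewrite memv0 => /eqP.
by case/eqP: nij; apply: (blk_inj (t := W)); apply: val_inj; rewrite /= -Ii.
Qed.

Lemma blk1_ortho i j : i != j -> blk1 i * blk1 j = 0.
Proof. by move=> nij; apply: (blk_mul0 nij); apply: blk1_in. Qed.

Lemma two_sided_ideal_minimal (I : {vspace top W}) :
  two_sided_ideal I -> I != 0%VS ->
  exists2 J, simple_ideal J & (J <= I)%VS.
Proof.
have [d leId] := ubnP (\dim I); elim: d I leId => // d IHd I leId I2 nzI.
have [simI|nsim] := EM (simple_ideal I); first by exists I.
have [J [J2 sJI nzJ nJI]] : exists J, [/\ two_sided_ideal J, (J <= I)%VS,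
    J != 0%VS & J != I].
  apply: contra_notP nsim => noJ; split=> // J J2 sJI.
  have [->|nzJ] := eqVneq J 0%VS; first by left.
  by right; apply/eqP; apply: contra_notT noJ => nJI; exists J.
have [|J' simJ' sJ'J] := IHd J _ J2 nzJ.
  apply: leq_trans (_ : \dim I <= d)%N; last by rewrite -ltnS.
  rewrite ltn_neqAle dimvS // andbT.
  by apply: contraNneq nJI => dJI; rewrite eqEdim sJI dJI leqnn.
by exists J' => //; apply: subv_trans sJI.
Qed.

(* The complementary ideal of the sum of the blocks contains no simple ideal. *)
Lemma sum_blk1 : \sum_i blk1 i = 1.
Proof.
set e := \sum_i _.
have eC t : t * e = e * t.
  by rewrite mulr_sumr mulr_suml; apply: eq_bigr => i _; apply: blk1_comm.
have eE i : e * blk1 i = blk1 i.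
  rewrite mulr_suml (bigD1 i) //= blk1_idem big1 ?addr0 // => j /blk1_ortho.
  by [].
have [I IP] : exists I : {vspace top W}, forall x, x \in I <-> e * x = 0.
  apply: vspace_of_pred; first by rewrite mulr0.
  by move=> c x y ex ey; rewrite mulrDr -scalerAr ex ey scaler0 addr0.
have I2 : two_sided_ideal I.
  apply/two_sided_idealP=> a x /IP ex; split; apply/IP.
    by rewrite mulrA -eC -mulrA ex mulr0.
  by rewrite mulrA ex mul0r.
have [I0|nzI] := eqVneq I 0%VS.
  suff : 1 - e \in I by rewrite I0 memv0 subr_eq0 => /eqP.
  apply/IP; rewrite mulrBr mulr1 [X in _ - X]mulr_sumr.
  by rewrite (eq_bigr _ (fun i _ => eE i)) subrr.
have [J simJ sJI] := two_sided_ideal_minimal I2 nzI.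
have [i Ji] := blk_all simJ; have := blk1_neq0 i.
rewrite -(eE i) (proj1 (IP _)) ?eqxx //.
by apply: (subvP sJI); rewrite Ji blk1_in.
Qed.

(** The two-sided ideal generated by [x] is nonzero and contained in a simple ideal, so it is the
    whole block and contains its unit. *)
Lemma blk_gen i x : x \in blk W i -> x != 0 ->
  exists q : seq (top W * top W), blk1 i = \sum_(p <- q) p.1 * x * p.2.
Proof.
move=> xi nzx; pose S y := exists q : seq (top W * top W),
  y = \sum_(p <- q) p.1 * x * p.2.
have SD y z : S y -> S z -> S (y + z).
  by move=> [q ->] [q' ->]; exists (q ++ q'); rewrite big_cat.
have SM a b y : S y -> S (a * y * b).
  case=> q ->; exists [seq (a * p.1, p.2 * b) | p <- q].
  by rewrite big_map mulr_sumr mulr_suml; apply: eq_bigr => p _; rewrite !mulrA.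
have S0 : S 0 by exists [::]; rewrite big_nil.
have [J JP] : exists J : {vspace top W}, forall y, y \in J <-> S y.
  apply: vspace_of_pred => // c y z Sy; apply: SD.
  by rewrite -[c *: y]mulr_algl -[X in S X]mulr1; apply: SM.
have J2 : two_sided_ideal J.
  apply/two_sided_idealP=> a y /JP Sy; split; apply/JP.
    by rewrite -[a * y]mulr1; apply: SM.
  by rewrite -[y]mul1r; apply: SM.
have Jx : x \in J.
  by apply/JP; exists [:: (1, 1)]; rewrite big_seq1 mul1r mulr1.
have [_ _ /(_ J J2)[||JE]] := blk_simple W i.
- apply/subvP=> _ /JP[q ->]; apply: memv_suml => p _.
  by have [/(blk_mul p.2)[]] := blk_mul p.1 xi.
- by move=> J0; move: Jx nzx; rewrite J0 memv0 => ->.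
by apply/JP; rewrite JE blk1_in.
Qed.

(** The last clause says that every nonzero element of top.e generates it, so top.e is a minimal
    left ideal; it serves as the model of the simple module of the block. *)
Definition primitive_idem i (e : top W) : Prop :=
  [/\ e \in blk W i, e != 0, e * e = e &
      forall t, t * e != 0 -> exists t', t' * (t * e) = e].

Lemma minimal_left_ideal i : exists L : {vspace top W},
  [/\ left_ideal L, (L <= blk W i)%VS, L != 0%VS &
      forall J, left_ideal J -> (J <= L)%VS -> J = 0%VS \/ J = L].
Proof.
pose P d := exists L : {vspace top W},
  [/\ left_ideal L, (L <= blk W i)%VS, L != 0%VS & \dim L = d].
have [i2 nz _] := blk_simple W i.
have exP : exists d, `[< P d >].
  exists (\dim (blk W i)); apply/asboolP; exists (blk W i); split=> //.
  by case/andP: i2.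
case: (ex_minnP exP) => d /asboolP[L [lL sLi nzL dL]] mind.
exists L; split=> // J lJ sJL; have [->|nzJ] := eqVneq J 0%VS; [by left|right].
apply/eqP; rewrite eqEdim sJL dL /=; apply: mind; apply/asboolP; exists J.
by split=> //; apply: subv_trans sLi.
Qed.

(** Brauer's lemma: a minimal left ideal with nonzero square contains a nonzero idempotent, which
    generates it. *)
Lemma primitive_idem_ex i : exists e, primitive_idem i e.
Proof.
have [L [lL sLi nzL minL]] := minimal_left_ideal i.
have /left_idealP LL := lL.
(* If L.L were zero, expanding the block unit as a sum of [p.1 * x * p.2] in x = x.1 would give x =
   0, because each [x * (p.1 * x)] is in L.L. *)
have [x [xL [y [yL nxy]]]] :
    exists x, x \in L /\ exists y, y \in L /\ x * y != 0.
  apply: contra_notP (elimN eqP nzL) => noxy.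
  apply/eqP; rewrite -subv0; apply/subvP=> x xL; rewrite memv0.
  apply/negPn/negP=> nzx; have xi := subvP sLi x xL.
  have [q qE] := blk_gen xi nzx.
  case/negP: nzx; rewrite -(blk1r xi) qE mulr_sumr big1 // => p _.
  rewrite !mulrA -[x * p.1 * x]mulrA.
  have [->|nz] := eqVneq (x * (p.1 * x)) 0; first by rewrite mul0r.
  by case: noxy; exists x; split=> //; exists (p.1 * x); split=> //; apply: LL.
(* [N] is the kernel of right multiplication by [y] on [L]. It misses [x], so it is zero by
   minimality. *)
have [N NP] : exists N : {vspace top W}, forall z, z \in N <-> z \in L /\ z * y = 0.
  apply: vspace_of_pred; first by rewrite mem0v mul0r.
  move=> c u v [uL uy] [vL vy]; split; first by rewrite memvD ?memvZ.
  by rewrite mulrDl -scalerAl uy vy scaler0 addr0.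
have N0 : N = 0%VS.
  have [||//|NL] := minL N.
  - apply/left_idealP=> a z /NP[zL zy]; apply/NP; split; first exact: LL.
    by rewrite -mulrA zy mulr0.
  - by apply/subvP=> z /NP[].
  by move: xL nxy; rewrite -NL => /NP[_ ->]; rewrite eqxx.
have Lgen z : z \in L -> z != 0 -> (fullv * <[z]>)%VS = L.
  move=> zL nz; have [||I0|//] := minL (fullv * <[z]>)%VS.
  - by rewrite /left_ideal prodvA prodvSl // subvf.
  - by apply/subvP=> _ /memv_cosetP[t _ ->]; apply: LL.
  have : z \in (fullv * <[z]>)%VS.
    by apply/memv_cosetP; exists 1; rewrite ?memvf ?mul1r.
  by rewrite I0 memv0 (negPf nz).
have /memv_cosetP[t _ yE] : y \in (fullv * <[(x * y)]>)%VS.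
  by rewrite Lgen // LL.
(* As [e * y = y], the element [e * e - e] lies in [N], hence vanishes. *)
pose e := t * x; have eL : e \in L by apply: LL.
have ey : e * y = y by rewrite -mulrA -yE.
have nze : e != 0.
  by apply: contraNneq nxy => e0; rewrite -ey e0 mul0r mulr0.
exists e; split=> //; first exact: (subvP sLi).
  apply/eqP; rewrite -subr_eq0 -memv0 -N0; apply/NP; split.
    by rewrite memvB // LL.
  by rewrite mulrBl -mulrA !ey subrr.
move=> u nzue; have /memv_cosetP[t' _ eE] : e \in (fullv * <[(u * e)]>)%VS.
  by rewrite Lgen // LL.
by exists t'.
Qed.

End Structure.

(** * Simple modules *)

Lemma cyclic_map (R : pzRingType) (M N : lmodType R) (x0 : M) (y0 : N) :
  (forall x, exists a : R, x = a *: x0) ->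
  (forall a : R, a *: x0 = 0 -> a *: y0 = 0) ->
  exists f : {linear M -> N}, forall a, f (a *: x0) = a *: y0.
Proof.
move=> /choice[g gE] wd; pose f x := g x *: y0.
have fE a : f (a *: x0) = a *: y0.
  apply/eqP; rewrite -subr_eq0 -scalerBl wd //.
  by rewrite scalerBl -gE subrr.
have fL : linear f.
  move=> a x y; rewrite {2 3}/f scalerA -scalerDl -fE.
  by rewrite scalerDl -scalerA -!gE.
by exists (lin fL).
Qed.

Section SimpleModules.
Variables (k : fieldType) (A : falgType k) (s : nat) (W : top_dec A s).
Implicit Types (i j : 'I_s) (M T : lmodType A).
Local Notation r := (rad W).
Local Notation pi := (topi W).

Lemma scaler_alg (M : lmodType A) (c : k) (a : A) (x : M) :
  (c *: a) *: x = c%:A *: (a *: x).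
Proof. by rewrite scalerA mulr_algl. Qed.

(** The annihilator of a nonzero element of a simple module is a maximal left ideal, so it contains
    the radical. *)
Lemma simple_rad M a x : simple_mod M -> a \in r -> a *: (x : M) = 0.
Proof.
move=> simM ar; have [->|nzx] := eqVneq x 0; first by rewrite scaler0.
have [I IP] : exists I : {vspace A}, forall b, b \in I <-> b *: x = 0.
  apply: vspace_of_pred; first by rewrite scale0r.
  by move=> c u v ux vx; rewrite scalerDl scaler_alg ux vx scaler0 addr0.
apply/IP/(proj1 (rad_radical W a)) => //; split.
- by apply/left_idealP=> b u /IP ux; apply/IP; rewrite -scalerA ux scaler0.
- apply: contraNneq nzx => If; have /IP : 1 \in I by rewrite If memvf.
  by rewrite scale1r => ->.
move=> J /left_idealP lJ sIJ.
(* An element [b] of [J] that moves [x] satisfies x = c.b.x for some [c]; then [1 - c * b] is in the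
   annihilator, and 1 is in [J]. *)
have [[b bJ]|noJ] := EM (exists2 b, b \in J & b *: x != 0).
  move/(simple_gen simM)/(_ x) => [c xE]; right.
  apply/eqP; rewrite eqEsubv subvf; apply/subvP=> a' _.
  have : 1 - c * b \in J.
    apply: (subvP sIJ); apply/IP.
    by rewrite scalerBl scale1r -scalerA -xE subrr.
  move/(memvD (lJ c b bJ)); rewrite addrC subrK => J1.
  by rewrite -[a']mulr1; apply: lJ.
left; apply/eqP; rewrite eqEsubv sIJ andbT; apply/subvP=> b bJ; apply/IP/eqP.
by apply: contra_notT noJ => nz; exists b.
Qed.

Lemma simple_act_eq M a b x : simple_mod M -> pi a = pi b ->
  a *: (x : M) = b *: x.
Proof.
move=> simM ab; apply/eqP; rewrite -subr_eq0 -scalerBl.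
by apply/eqP/simple_rad; rewrite // mem_rad linearB /= ab subrr.
Qed.

Lemma simple_at1 i T a x : simple_at W i T -> pi a = blk1 W i ->
  a *: (x : T) = x.
Proof.
move=> [simT [b [y [bi nz]]]] aE.
have := simple_gen simT nz x => -[c ->]; rewrite !scalerA.
apply: simple_act_eq => //; rewrite mem_blk_pre in bi.
by rewrite !topiM aE -blk1_comm -mulrA blk1_comm blk1l.
Qed.

Lemma simple_at0 i T a x : simple_at W i T -> pi a * blk1 W i = 0 ->
  a *: (x : T) = 0.
Proof.
move=> sT a0; have [e eE] := topi_ex (blk1 W i).
rewrite -(simple_at1 x sT eE) scalerA; apply: simple_rad; first by case: sT.
by rewrite mem_rad topiM eE a0.
Qed.

Lemma simple_at_ex M : simple_mod M -> exists i, simple_at W i M.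
Proof.
move=> simM; apply: contrapT => no; have [[x /eqP nzx] _] := simM; apply: nzx.
have /choice[e eE] := fun i => topi_ex (blk1 W i).
rewrite -[LHS]scale1r (@simple_act_eq _ _ (\sum_i e i)) //; last first.
  by rewrite topi1 linear_sum -(sum_blk1 W); apply: eq_bigr => i _; rewrite /= eE.
rewrite scaler_suml big1 // => i _; apply/eqP; apply: contra_notT no => nz.
exists i; split=> //; exists (e i), x; split=> //.
by rewrite mem_blk_pre eE blk1_in.
Qed.

Lemma simple_at_inj i j M : simple_at W i M -> simple_at W j M -> i = j.
Proof.
move=> Mi Mj; apply/eqP; apply: contraT => nij; have [[[x /eqP nzx] _] _] := Mi.
have [e eE] := topi_ex (blk1 W i); case: nzx.
by rewrite -(simple_at1 x Mi eE) (simple_at0 x Mj) // eE blk1_ortho.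
Qed.

Lemma simple_at_mod_iso i M N :
  simple_mod M -> mod_iso M N -> simple_at W i N -> simple_at W i M.
Proof.
move=> simM [f [g fK gK]] [_ [a [y [ai nz]]]]; split=> //; exists a, (g y).
split=> //; apply: contraNneq nz => a0.
by rewrite -[y]gK -linearZ /= a0 linear0.
Qed.

Section Primitive.
Variables (i : 'I_s) (e : top W) (c : A).
Hypotheses (ePI : primitive_idem i e) (cE : pi c = e).

(** The block is the two-sided ideal generated by [e]. If [c] killed [T], so would a lift of the
    block unit, which acts as the identity. *)
Lemma primitive_fixed T : simple_at W i T ->
  exists x : T, x != 0 /\ c *: x = x.
Proof.
move=> sT; have [ei nze ee eV] := ePI; have simT := proj1 sT.
have [y nzy] : exists y : T, c *: y != 0.
  apply: contrapT => no; have [[x /eqP nzx] _] := simT; apply: nzx.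
  have [q qE] := blk_gen ei nze; have [d dE] := topi_ex (blk1 W i).
  have /choice[l lE] := topi_ex (W := W).
  rewrite -(simple_at1 x sT dE).
  rewrite (@simple_act_eq _ _ (\sum_(p <- q) l p.1 * c * l p.2)) //.
    rewrite scaler_suml big1 // => p _; rewrite -!scalerA.
    suff -> : c *: (l p.2 *: x) = 0 by rewrite scaler0.
    by apply/eqP; apply: contra_notT no => nz; exists (l p.2 *: x).
  rewrite dE qE linear_sum; apply: eq_bigr => p _ /=.
  by rewrite !topiM !lE cE.
exists (c *: y); split=> //; rewrite scalerA; apply: simple_act_eq => //.
by rewrite topiM cE.
Qed.

(** A nonzero [pi a * e] can be multiplied back to [e], and so [a *: x] back to [x]. This makes a.x
    |-> pi(a).e an identification of [T] with top.e. *)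
Lemma primitive_ann T (x : T) a : simple_at W i T -> x != 0 -> c *: x = x ->
  a *: x = 0 <-> pi a * e = 0.
Proof.
move=> sT nzx cx; have [ei nze ee eV] := ePI; have simT := proj1 sT.
split=> [ax|ae]; last first.
  by rewrite -cx scalerA simple_rad // mem_rad topiM cE ae.
have [//|/eV[t tE]] := eqVneq (pi a * e) 0.
have [b bE] := topi_ex t; case/eqP: nzx; rewrite -cx.
rewrite (@simple_act_eq _ _ (b * (a * c))) // ?topiM ?cE ?bE //.
by rewrite -!scalerA cx ax scaler0.
Qed.
End Primitive.

(** Both modules have generators with the same annihilator, read off from one primitive
    idempotent. *)
Lemma simple_at_iso i M N : simple_at W i M -> simple_at W i N -> mod_iso M N.
Proof.
move=> Mi Ni; have [e ePI] := primitive_idem_ex W i; have [c cE] := topi_ex e.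
have [x [nzx cx]] := primitive_fixed ePI cE Mi.
have [y [nzy cy]] := primitive_fixed ePI cE Ni.
have [simM simN] := (proj1 Mi, proj1 Ni).
have [a|f fE] := cyclic_map (simple_gen simM nzx) (y0 := y).
  by move/(primitive_ann ePI cE a Mi nzx cx)/(primitive_ann ePI cE a Ni nzy cy).
apply: simple_mod_iso => //; exists f, x.
by rewrite -[x]scale1r fE scale1r.
Qed.

(** * Dimensions of a simple module, its endomorphism ring and its block *)

Section Dimensions.
Variables (i : 'I_s) (e : top W) (T : lmodType A).
Hypotheses (ePI : primitive_idem i e) (sT : simple_at W i T).

(** [X] is a copy of [T], and [Y] a copy of the opposite of its endomorphism ring. *)
Let X : {vspace top W} := (fullv * <[e]>)%VS.
Let Y : {vspace top W} := (<[e]> * fullv * <[e]>)%VS.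

Let ee : e * e = e. Proof. by case: ePI. Qed.

Let memX x : (x \in X) <-> x * e = x.
Proof.
split=> [/memv_cosetP[t _ ->]|<-]; first by rewrite -mulrA ee.
by apply/memv_cosetP; exists x; rewrite ?memvf.
Qed.

Let memY x : (x \in Y) <-> x * e = x /\ e * x = x.
Proof.
split.
  case/memv_cosetP=> u ufe ->; split; first by rewrite -mulrA ee.
  have eY : (<[e]> * fullv <= lker (amull e - \1%VF))%VS.
    apply/prodvP=> _ t /vlineP[l ->] _; rewrite memv_ker !lfunE /= opp_lfunE.
    by rewrite id_lfunE lfunE /= -scalerAl -scalerAr mulrA ee subrr.
  have := subvP eY u ufe; rewrite memv_ker !lfunE /= opp_lfunE id_lfunE lfunE.
  by rewrite /= subr_eq0 mulrA => /eqP->.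
case=> xe ex; apply/memv_cosetP; exists x => //.
by rewrite -ex; apply: memv_mul; rewrite ?memvf ?memv_line.
Qed.

Lemma simple_coord : exists (x0 : T) (tau : T -> subvs_of X),
  [/\ x0 != 0, forall a, pi a = e -> a *: x0 = x0,
   forall a, vsval (tau (a *: x0)) = pi a * e & bijective tau].
Proof.
have [c cE] := topi_ex e; have [x0 [nzx cx]] := primitive_fixed ePI cE sT.
have gen := simple_gen (proj1 sT) nzx; have /choice[g gE] := gen.
have ann a := primitive_ann ePI cE a sT nzx cx.
have wd a b : a *: x0 = b *: x0 <-> pi a * e = pi b * e.
  have := ann (a - b); rewrite linearB scalerBl mulrBl => -[ab ba]; split.
    by move/eqP; rewrite -subr_eq0 => /eqP/ab/eqP; rewrite subr_eq0 => /eqP.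
  by move/eqP; rewrite -subr_eq0 => /eqP/ba/eqP; rewrite subr_eq0 => /eqP.
have gX x : pi (g x) * e \in X by apply/memX; rewrite -mulrA ee.
exists x0, (fun x => vsproj X (pi (g x) * e)); split=> //.
- move=> a aE; rewrite -[RHS]cx; apply: simple_act_eq; first by case: sT.
  by rewrite aE cE.
- by move=> a; rewrite vsprojK //; apply/wd; rewrite -gE.
have /choice[l lE] := topi_ex (W := W).
exists (fun u => l (vsval u) *: x0) => [x|u].
  rewrite vsprojK // [RHS]gE; apply/wd; rewrite lE -mulrA ee //.
apply: val_inj; rewrite /= vsprojK //; transitivity (pi (l (vsval u)) * e).
  by apply/wd; rewrite -gE.
by rewrite lE; apply/memX/subvsP.
Qed.

Lemma dim_regular : \dim {: k^o} = 1%N.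
Proof. by rewrite dimvf. Qed.

Lemma dim_subvs (V : vectType k) (U : {vspace V}) : \dim {: subvs_of U} = \dim U.
Proof. by rewrite dimvf. Qed.

Lemma dim_mod_simple : dim_mod T = \dim X.
Proof.
have [x0 [tau [nzx0 ex0 tauE tauB]]] := simple_coord.
have gen := simple_gen (proj1 sT) nzx0.
have tauL (c : k) x y : tau (c%:A *: x + y) = c *: tau x + tau y.
  have [a ->] := gen x; have [b ->] := gen y; apply: val_inj.
  rewrite -scaler_alg -scalerDl /= !tauE linearP /=.
  by rewrite mulrDl scalerAl.
have tau0 : tau 0 = 0.
  by apply: val_inj; rewrite /= -(scale0r x0) tauE linear0 mul0r.
have [tau' tauK tauK'] := tauB.
rewrite -[LHS]muln1 -dim_regular -(dim_subvs X) /dim_mod.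
apply: (@dimensionE k k^o (subvs_of X) (fun c v => (c : k) *: v) *%R _ _ _ _ _
  T (fun=> True) (fun x => x = 0) k _ tau id) => //.
- by rewrite dim_regular.
- by move=> v a c d; rewrite scalerDl scalerA.
- by move=> c u v; rewrite scalerBr.
- by move=> c d v; rewrite scalerA.
- by move=> c nzc; exists c^-1 => v; rewrite scalerA mulVf ?scale1r.
- by move=> x y _ _; have := tauL (-1) y x; rewrite !scaleN1r !(addrC (- _)).
- by move=> v; exists (tau' v).
- by move=> x _; split=> [->|tx]; rewrite ?tau0 // -[x]tauK tx -tau0 tauK.
- by move=> c x _; exists (c%:A *: x).
- by move=> c x y _ ->; split=> //; rewrite -[c%:A *: x]addr0 tauL tau0 addr0.
- by exists id.
Qed.

(** An endomorphism is determined by the image of [x0]. Since [c] fixes [x0], it fixes this image as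
    well, which [tau] therefore sends into e.top.e. *)
Lemma dim_End_simple : dim_End T = \dim Y.
Proof.
have [x0 [tau [nzx0 ex0 tauE tauB]]] := simple_coord.
have gen := simple_gen (proj1 sT) nzx0; have [tau' tauK tauK'] := tauB.
have [c cE] := topi_ex e; have /choice[l lE] := topi_ex (W := W).
pose P (f : T -> T) := vsproj Y (vsval (tau (f x0))).
have PE f a : linear f -> f x0 = a *: x0 -> vsval (P f) = pi a * e.
  move=> fL fa; rewrite /P vsprojK fa tauE //; apply/memY.
  have := congr1 (vsval \o tau) fa; rewrite /= tauE => <-.
  have -> : f x0 = (c * a) *: x0.
    by rewrite -scalerA -fa -{1}(ex0 c cE) lin_scale.
  by rewrite tauE topiM cE -!mulrA ee !mulrA ee.
have act0 a : a *: x0 = 0 <-> pi a * e = 0.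
  rewrite -tauE; split=> [->|a0].
    by rewrite -(scale0r x0) tauE linear0 mul0r.
  rewrite -[a *: x0]tauK (_ : tau _ = tau 0) ?tauK //.
  by apply: val_inj; rewrite /= a0 -(scale0r x0) tauE linear0 mul0r.
rewrite -[LHS]muln1 -dim_regular -(dim_subvs Y) /dim_End.
apply: (@dimensionE k k^o (subvs_of Y) (fun c v => (c : k) *: v) *%R _ _ _ _ _
  (T -> T) (fun f => linear f) (fun f => f = 0) k _ P id).
- by rewrite dim_regular.
- by move=> v a b d; rewrite scalerDl scalerA.
- by move=> a u v; rewrite scalerBr.
- by move=> a b v; rewrite scalerA.
- by move=> a nza; exists a^-1 => v; rewrite scalerA mulVf ?scale1r.
- exact: lin_subr.
- move=> f g fL gL; have [a aE] := gen (f x0); have [b bE] := gen (g x0).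
  apply: val_inj; rewrite /= (PE f a) // (PE g b) // -mulrBl.
  rewrite (PE _ (a - b)); first by rewrite linearB.
    exact: lin_subr.
  by rewrite scalerBl -aE -bE.
- move=> v; have /memY[ve ev] := subvsP v.
  (* Right multiplication by [v] is well defined on [T] because v = e.v, so whatever kills [e] kills
     [v]. *)
  have [a|f fE] := cyclic_map gen (y0 := l (vsval v) *: x0).
    move/act0=> a0; rewrite scalerA; apply/act0.
    by rewrite topiM lE -mulrA ve -ev mulrA a0 mul0r.
  have fL : linear f by move=> a x y; rewrite linearP.
  exists (f : T -> T); split=> //; apply: val_inj; rewrite /= (PE _ (l (vsval v))) //.
    by rewrite lE ve.
  by rewrite -{1}[x0]scale1r fE scale1r.
- move=> f fL; have [a aE] := gen (f x0); split=> [f0|/(congr1 vsval)].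
    have /act0 a0 : a *: x0 = 0 by rewrite -aE f0.
    by apply: val_inj; rewrite /= (PE f a) // a0.
  rewrite (PE f a) // linear0 => /act0 a0; apply/funext=> x.
  by have [b ->] := gen x; rewrite lin_scale // aE a0 scaler0.
- by move=> a f fL; exists (fun x => a%:A *: f x).
- move=> d f g fL gE; have [a aE] := gen (f x0); have gL : linear g.
    move=> b x y; rewrite !gE fL scalerDr !scalerA; congr (_ *: _ + _).
    by rewrite mulr_algl mulr_algr.
  split=> //; apply: val_inj; rewrite /= (PE f a) //.
  rewrite (PE g (d *: a)) //; first by rewrite linearZ /= scalerAl.
  by rewrite gE aE -scaler_alg.
- by exists id.
Qed.

(* The products [p l * e * a m] are matrix units of the block over the division
   algebra e.top.e; they are built greedily, each time splitting off a copy of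
   top.e from the idempotent [blk1 W i - \sum_l p l * a l]. *)
Lemma dual_bases : exists n (p a : 'I_n -> top W),
  [/\ forall l, p l * e = p l, forall l, e * a l = a l,
      forall l m, a l * p m = (l == m)%:R * e &
      \sum_l p l * a l = blk1 W i].
Proof.
have [ei nze _ eV] := ePI.
pose P n (p a : 'I_n -> top W) := [/\ forall l, p l * e = p l,
  forall l, e * a l = a l & forall l m, a l * p m = (l == m)%:R * e].
have exP : exists n, `[< exists p a, @P n p a >].
  by exists 0%N; apply/asboolP; exists (fun=> 0), (fun=> 0); split=> -[].
(* Multiplying a linear relation among the [p l] by one [a l] isolates its coefficient; independence
   over [k] bounds [n]. *)
have ubP n : `[< exists p a, @P n p a >] -> (n <= \dim {: top W})%N.
  move/asboolP=> [p [a [pe ea ap]]]; rewrite -[n]muln1 -dim_regular.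
  apply: (@free_family_dim k k^o (top W) n (fun l c => (c : k) *: p l)).
    by move=> l b c d; rewrite scalerDl scalerA.
  move=> c c0 l; have := congr1 ( *%R (a l)) c0; rewrite mulr0 mulr_sumr.
  rewrite (bigD1 l) //= big1 => [|m nml]; last first.
    by rewrite -scalerAr ap eq_sym (negPf nml) mul0r scaler0.
  rewrite addr0 -scalerAr ap eqxx mul1r => /eqP.
  by rewrite scaler_eq0 (negPf nze) orbF => /eqP.
case: (ex_maxnP exP ubP) => n /asboolP[p [a [pe ea ap]]] maxn.
exists n, p, a; split=> //; apply/eqP; rewrite -subr_eq0 -oppr_eq0 opprB.
apply/negPn/negP; set f := \sum_l _; set g := _ - f => nzg.
have pi_ l : p l \in blk W i by rewrite -pe; case: (blk_mul (p l) ei).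
have ai_ l : a l \in blk W i by rewrite -ea; case: (blk_mul (a l) ei).
have fp m : f * p m = p m.
  rewrite mulr_suml (bigD1 m) //= big1 => [|l nlm].
    by rewrite addr0 -mulrA ap eqxx mul1r pe.
  by rewrite -mulrA ap (negPf nlm) mul0r mulr0.
have af m : a m * f = a m.
  rewrite mulr_sumr (bigD1 m) //= big1 => [|l nlm].
    by rewrite addr0 mulrA ap eqxx mul1r ea.
  by rewrite mulrA ap eq_sym (negPf nlm) !mul0r.
have gp m : g * p m = 0 by rewrite mulrBl fp blk1l ?subrr.
have ag m : a m * g = 0 by rewrite mulrBr af blk1r ?subrr.
have gi : g * blk1 W i = g.
  rewrite mulrBl blk1_idem; congr (_ - _).
  by rewrite mulr_suml; apply: eq_bigr => l _; rewrite -mulrA blk1r.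
have gg : g * g = g.
  have gf : g * f = 0.
    by rewrite mulr_sumr big1 // => l _; rewrite mulrA gp mul0r.
  by rewrite {2}/g mulrBr gf subr0 gi.
have [t nzt] : exists t, g * (t * e) != 0.
  apply: contrapT => no; case/negP: nzg; have [q qE] := blk_gen ei nze.
  rewrite -gi qE mulr_sumr big1 // => x _; rewrite mulrA.
  have [->|nz] := eqVneq (g * (x.1 * e)) 0; first by rewrite mul0r.
  by case: no; exists x.1.
have [b bE] : exists b, b * (g * (t * e)) = e.
  by rewrite mulrA; apply: eV; rewrite -mulrA.
suff : (n.+1 <= n)%N by rewrite ltnn.
apply: maxn; apply/asboolP.
(* The new pair is g.t.e and e.b.g. Their product is [e] because [g] is idempotent and b.g.t.e = e;
   the mixed products vanish because a.g = 0 and g.p = 0. *)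
exists (fun l => oapp p (g * (t * e)) (unlift ord_max l)).
exists (fun l => oapp a (e * b * g) (unlift ord_max l)).
split.
- by move=> l; case: unliftP => [m _|_] /=; rewrite ?pe // -!mulrA ee.
- by move=> l; case: unliftP => [m _|_] /=; rewrite ?ea // !mulrA ee.
move=> l m; case: (unliftP ord_max l) => [l' ->|->];
  case: (unliftP ord_max m) => [m' ->|->] /=.
- by rewrite ap (inj_eq (@lift_inj _ _)).
- by rewrite mulrA ag mul0r eq_sym (negPf (neq_lift _ _)) mul0r.
- by rewrite -mulrA gp mulr0 (negPf (neq_lift _ _)) mul0r.
- by rewrite eqxx mul1r -!mulrA [g * (g * _)]mulrA gg bE ee.
Qed.

(** The dual bases split the block into [n] copies of top.e and top.e into [n] copies of e.top.e.
    Eliminating [n] gives the square. *)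
Lemma dim_blk_simple : (\dim (blk W i) * dim_End T = dim_mod T ^ 2)%N.
Proof.
rewrite dim_End_simple dim_mod_simple; have [n [p [a [pe ea ap paE]]]] := dual_bases.
have [ei _ _ _] := ePI.
have ai l : a l \in blk W i by rewrite -ea; case: (blk_mul (a l) ei).
have Xi x : x \in X -> x \in blk W i.
  by move/memX=> <-; case: (blk_mul x ei).
have dA : \dim (blk W i) = (n * \dim X)%N.
  rewrite -(dim_subvs (blk W i)) -(dim_subvs X).
  apply: (@basis_family_dim _ _ _ _ (fun l (z : subvs_of X) =>
    vsproj (blk W i) (vsval z * a l))).
    by move=> l c u v; rewrite linearP /= mulrDl -scalerAl linearP.
  have val_sum (c : 'I_n -> subvs_of X) :
      vsval (\sum_l vsproj (blk W i) (vsval (c l) * a l)) =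
      \sum_l vsval (c l) * a l.
    rewrite linear_sum; apply: eq_bigr => l _ /=; rewrite vsprojK //.
    by case: (blk_mul (vsval (c l)) (ai l)).
  move=> v; exists (fun l => vsproj X (vsval v * p l)); split.
    apply: val_inj; rewrite /= val_sum -[LHS](blk1r (subvsP v)) -paE mulr_sumr.
    apply: eq_bigr => l _; rewrite vsprojK ?mulrA //.
    by apply/memX; rewrite -mulrA pe.
  move=> c /(congr1 vsval); rewrite val_sum => vE; apply/funext=> m.
  have mX : vsval v * p m \in X by apply/memX; rewrite -mulrA pe.
  apply: val_inj; rewrite /= vsprojK // vE mulr_suml (bigD1 m) //= big1.
    by rewrite addr0 -mulrA ap eqxx mul1r; apply/memX/subvsP.
  by move=> l nlm; rewrite -mulrA ap (negPf nlm) mul0r mulr0.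
have dX : \dim X = (n * \dim Y)%N.
  rewrite -(dim_subvs X) -(dim_subvs Y).
  apply: (@basis_family_dim _ _ _ _ (fun l (w : subvs_of Y) =>
    vsproj X (p l * vsval w))).
    by move=> l c u v; rewrite linearP /= mulrDr -scalerAr linearP.
  have pX l w : w \in Y -> p l * w \in X.
    by move/memY=> [we _]; apply/memX; rewrite -mulrA we.
  have val_sum (c : 'I_n -> subvs_of Y) :
      vsval (\sum_l vsproj X (p l * vsval (c l))) = \sum_l p l * vsval (c l).
    by rewrite linear_sum; apply: eq_bigr => l _ /=; rewrite vsprojK ?pX ?subvsP.
  have aY l x : x \in X -> a l * x \in Y.
    by move/memX=> xe; apply/memY; rewrite -mulrA xe mulrA ea.
  move=> v; have vX := subvsP v; exists (fun l => vsproj Y (a l * vsval v)); split.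
    apply: val_inj; rewrite /= val_sum -[LHS](blk1l (Xi _ vX)) -paE mulr_suml.
    by apply: eq_bigr => l _; rewrite vsprojK ?mulrA // aY.
  move=> c /(congr1 vsval); rewrite val_sum => vE; apply/funext=> m.
  apply: val_inj; rewrite /= vsprojK ?aY // vE mulr_sumr (bigD1 m) //= big1.
    by rewrite addr0 mulrA ap eqxx mul1r; case/memY: (subvsP (c m)).
  by move=> l nlm; rewrite mulrA ap eq_sym (negPf nlm) !mul0r.
by rewrite dA expnS expn1 mulnAC -dX.
Qed.
End Dimensions.
End SimpleModules.

(** * Equivalences of module categories *)

Lemma bij_lin_inv (R : pzRingType) (M N : lmodType R) (f : {linear M -> N}) :
  bijective f -> exists g : {linear N -> M}, cancel f g /\ cancel g f.
Proof.
case=> g fK gK; have gL : linear g.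
  by move=> a x y; rewrite -{1}[x]gK -{1}[y]gK -linearP fK.
by exists (lin gL).
Qed.

Lemma lin_factor (R : pzRingType) (L M N : lmodType R) (f : {linear L -> M})
    (g : {linear N -> M}) :
  injective f -> (forall x, exists y, f y = g x) ->
  exists h : {linear N -> L}, forall x, f (h x) = g x.
Proof.
move=> fI /choice[h hE]; have hL : linear h.
  by move=> a x y; apply: fI; rewrite hE !linearP !hE.
by exists (lin hL).
Qed.

Lemma lin_quotient (R : pzRingType) (L M N : lmodType R) (f : {linear L -> M})
    (g : L -> N) :
  linear g -> (forall y, exists x, f x = y) -> (forall x, f x = 0 -> g x = 0) ->
  exists h : {linear M -> N}, forall x, h (f x) = g x.
Proof.
move=> gL /choice[e eK] wd.
have gE x y : f x = f y -> g x = g y.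
  move=> fxy; have := wd (-1 *: x + y); rewrite linearP gL fxy !scaleN1r addNr.
  by move/(_ (erefl _))/eqP; rewrite addrC subr_eq0 => /eqP.
have hL : linear (g \o e).
  by move=> a x y; rewrite /= -gL; apply: gE; rewrite linearP !eK.
by exists (lin hL) => x; apply: gE; rewrite eK.
Qed.

Definition mul_elt (R : pzRingType) (M : lmodType R) (x : M) (b : R^o) : M :=
  (b : R) *: x.

Lemma mul_elt_linear (R : pzRingType) (M : lmodType R) (x : M) :
  linear (mul_elt x).
Proof. by move=> a b c; rewrite /mul_elt scalerDl scalerA. Qed.

(** Functors act on morphisms, not on elements; an element is replaced by the map from the regular
    module that sends 1 to it. *)
Definition mul_at (R : pzRingType) (M : lmodType R) (x : M) :
  {linear R^o -> M} := lin (mul_elt_linear x).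

Lemma mul_atE (R : pzRingType) (M : lmodType R) (x : M) (b : R) : mul_at x b = b *: x.
Proof. by []. Qed.

Section Functor.
Variables (k : fieldType) (A B : falgType k) (F : klin_functor A B).

Lemma fmap_eqcomp (L M N : lmodType A) (g : {linear M -> N})
    (f : {linear L -> M}) (h : {linear L -> N}) :
  (forall x, h x = g (f x)) -> forall y, fmap F h y = fmap F g (fmap F f y).
Proof.
move=> hE y; rewrite -[RHS](fmap_comp g f).
by congr (fmap F _ y); apply: linear_ext.
Qed.

Lemma fmap_eq (M N : lmodType A) (f g : {linear M -> N}) :
  f =1 g -> fmap F f =1 fmap F g.
Proof. by move/linear_ext->. Qed.

(** Linearity of a functor is given for combinations c.f + g only; the zero map is written as (-1).f
    + f. *)
Lemma fmap0 (M N : lmodType A) (f : {linear M -> N}) :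
  (forall x, f x = 0) -> forall y, fmap F f y = 0.
Proof.
move=> f0 y.
have fE x : f x = (-1 : k)%:A *: f x + f x by rewrite !f0 scaler0 addr0.
by rewrite (fmap_linear fE) !scaleN1r addNr.
Qed.

Lemma fmap_comp0 (L M N : lmodType A) (g : {linear M -> N}) (f : {linear L -> M}) :
  (forall x, g (f x) = 0) -> forall y, fmap F g (fmap F f y) = 0.
Proof. by move=> gf0 y; rewrite -[LHS](fmap_comp g f) fmap0. Qed.

Lemma fmapB (M N : lmodType A) (f g h : {linear M -> N}) :
  (forall x, h x = f x - g x) -> forall y, fmap F h y = fmap F f y - fmap F g y.
Proof.
move=> hE y; have fE x : h x = (-1 : k)%:A *: g x + f x.
  by rewrite !scaleN1r addrC.
by rewrite (fmap_linear fE) !scaleN1r addrC.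
Qed.

End Functor.

Section FullyFaithful.
Variables (k : fieldType) (A B : falgType k).
Variables (F : klin_functor A B) (G : klin_functor B A).
Variables (eta : unit_iso F G).

Lemma fmap_inj (M N : lmodType A) (f g : {linear M -> N}) :
  fmap F f =1 fmap F g -> f =1 g.
Proof.
move=> fg x; apply: (bij_inj (unit_bij eta N)).
by rewrite !unit_nat (fmap_eq (F := G) fg).
Qed.

Lemma fmap_nz (M N : lmodType A) (f : {linear M -> N}) :
  (exists x, f x != 0) -> exists y, fmap F f y != 0.
Proof.
move=> [x nz]; apply: contrapT => no; case/eqP: nz.
have F0 y : fmap F f y = 0.
  by apply/eqP; apply: contra_notT no => nz; exists y.
apply: (bij_inj (unit_bij eta N)); rewrite unit_nat linear0.
exact: fmap0.
Qed.
End FullyFaithful.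

Section Equivalence.
Variables (k : fieldType) (A B : falgType k).
Variables (F : klin_functor A B) (G : klin_functor B A).
Variables (eta : unit_iso F G) (eps : unit_iso G F).

(** The preimage is the conjugate of G(h) by the unit. Naturality gives G(F(f)) = G(h), and [G] is
    faithful thanks to [eps]. *)
Lemma fmap_full (M N : lmodType A) (h : {linear F M -> F N}) :
  exists f : {linear M -> N}, fmap F f =1 h.
Proof.
have [e [eK Ke]] := bij_lin_inv (unit_bij eta N).
exists (e \o fmap G h \o unit_map eta M); apply: (fmap_inj eps) => y.
have [e' eK' Ke'] := unit_bij eta M.
by rewrite -[y]Ke' -unit_nat /= Ke.
Qed.

End Equivalence.

Section EquivalenceKernel.
Variables (k : fieldType) (A B : falgType k).
Variables (F : klin_functor A B) (G : klin_functor B A).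
Variables (eta : unit_iso F G) (eps : unit_iso G F).

(** For [z] killed by the inclusion, G([mul_at z]) followed by the inverse unit is a map into the
    kernel whose composite with the inclusion is zero. So it is zero, and [G] is faithful. *)
Lemma kernel_fmap_inj (L M : lmodType A) (f : {linear L -> M}) :
  injective (fmap F (kernel_incl f)).
Proof.
move=> x y xy; apply/eqP; rewrite -subr_eq0; apply/eqP.
set z := x - y; have z0 : fmap F (kernel_incl f) z = 0.
  by rewrite linearB /= xy subrr.
suff : mul_at z =1 mul_at (0 : F (kernel f)).
  by move/(_ 1); rewrite !mul_atE scaler0 scale1r.
apply: (fmap_inj eps) => u.
have [e [eK Ke]] := bij_lin_inv (unit_bij eta (kernel f)).
rewrite [RHS]fmap0; last by move=> b; rewrite mul_atE scaler0.
rewrite -[LHS]Ke (_ : e _ = 0) ?linear0 //; apply: val_inj => /=.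
apply: (bij_inj (unit_bij eta L)).
rewrite -[kernel_val _]/(kernel_incl f _) unit_nat Ke linear0.
by rewrite fmap_comp0 // => b; rewrite mul_atE linearZ /= z0 scaler0.
Qed.

(** The map G(B) -> L belonging to [z] lands in the kernel of [f]. Fullness of [G] turns its lift
    into a map from B, whose value at 1 is the preimage. *)
Lemma kernel_fmap_ex (L M : lmodType A) (f : {linear L -> M}) (z : F L) :
  fmap F f z = 0 -> exists y, fmap F (kernel_incl f) y = z.
Proof.
move=> fz; have [e [eK Ke]] := bij_lin_inv (unit_bij eta L).
have [x|g gE] := @kernel_lift _ _ _ f _ (e \o fmap G (mul_at z)).
  apply: (bij_inj (unit_bij eta M)); rewrite unit_nat linear0 /= Ke.
  by rewrite fmap_comp0 // => b; rewrite mul_atE linearZ /= fz scaler0.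
have [d dE] := fmap_full eps eta (unit_map eta (kernel f) \o g).
exists (d 1); rewrite -[RHS]scale1r -mul_atE.
pose h : {linear B^o -> F L} := fmap F (kernel_incl f) \o d.
suff : h =1 mul_at z by apply.
apply: (fmap_inj eps) => u.
rewrite (@fmap_eqcomp _ _ _ G _ _ _ (fmap F (kernel_incl f)) d) // dE /=.
by rewrite -unit_nat gE /= Ke.
Qed.
End EquivalenceKernel.

(** * Transport of the first extension group *)

Section Cocycles.
Variables (k : fieldType) (A : falgType k) (M N : lmodType A).
Variable P : proj_resolution M.
Implicit Types f g : res_mod P 1 -> N.

Lemma cocycle1B f g : cocycle1 f -> cocycle1 g -> cocycle1 (f - g).
Proof.
move=> [fL f0] [gL g0]; split; first exact: lin_subr.
by move=> x; rewrite -[LHS]/(f _ - g _) f0 g0 subrr.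
Qed.

Lemma Ext1_lact_cocycle d f g : cocycle1 f -> Ext1_lact d f g -> cocycle1 g.
Proof.
move=> [fL f0] gE; split; first by move=> a x y; rewrite !gE fL linearP.
by move=> x; rewrite gE f0 linear0.
Qed.

Lemma Ext1_lact_ex d f : exists g, Ext1_lact d f g.
Proof. by exists (fun x => d (f x)). Qed.

Lemma Ext1_ract_cocycle d f g : cocycle1 f -> Ext1_ract d f g -> cocycle1 g.
Proof.
move=> [fL f0] [d0 [d1 [d0E d1E gE]]]; split.
  by move=> a x y; rewrite !gE linearP fL.
move=> x; rewrite gE; have dd : res_diff P 0 (res_diff P 1 x) = 0.
  by apply/res_exact; exists x.
have /res_exact[y ->] : res_diff P 0 (d1 (res_diff P 1 x)) = 0.
  by rewrite d1E dd linear0.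
exact: f0.
Qed.

(** By this map every cocycle on P_1 descends to the kernel of the augmentation, so Ext^1 can be
    computed from P_0 -> M. *)
Lemma res_diff_onto : exists d : {linear res_mod P 1 -> kernel (res_aug P)},
  (forall x, kernel_incl (res_aug P) (d x) = res_diff P 0 x) /\
  (forall z, exists x, d x = z).
Proof.
have [x|d dE] := @kernel_lift _ _ _ (res_aug P) _ (res_diff P 0).
  by apply/res_exact0; exists x.
exists d; split=> // z; have /res_exact0[x xE] := kernel_incl0 z.
by exists x; apply: val_inj; rewrite -[LHS]/(kernel_incl _ _) dE -xE.
Qed.

Lemma Ext1_ract_ex d f : exists g, Ext1_ract d f g.
Proof.
have [d0 d0E] := res_projective (d \o res_aug P) (@res_surj _ _ _ P).
have [del [delE onto]] := res_diff_onto.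
have [x|e eE] := @kernel_lift _ _ _ (res_aug P) _ (d0 \o res_diff P 0).
  rewrite /= d0E /= (_ : res_aug P _ = 0) ?linear0 //.
  by apply/res_exact0; exists x.
have [d1 d1E] := res_projective e onto.
exists (fun x => f (d1 x)), d0, d1; split=> // x.
by rewrite -delE d1E eE.
Qed.
End Cocycles.

(* A map defined on the left ideal of the annihilator of [x0] only: its values
   elsewhere are irrelevant. *)
Definition ann_linear (R : pzRingType) (M N : lmodType R) (x0 : M) (h : R -> N) :=
  forall a b c, b *: x0 = 0 -> c *: x0 = 0 -> h (a * b + c) = a *: h b + h c.

(** Maps from the regular module are b |-> b.y, so the condition says that [h] extends from the
    annihilator to the whole ring. *)
Definition ann_cob (R : pzRingType) (M N : lmodType R) (x0 : M) (h : R -> N) :=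
  exists y, forall b, b *: x0 = 0 -> h b = b *: y.

Section ExtTransport.
Variables (k : fieldType) (A B : falgType k).
Variables (F : klin_functor A B) (G : klin_functor B A).
Variables (eta : unit_iso F G) (eps : unit_iso G F).

Lemma end_transport (M : lmodType A) (SM : lmodType B) (sM : {linear F M -> SM}) :
  bijective sM -> exists th : {linear M -> M} -> {linear SM -> SM},
    (forall d z, th d (sM z) = sM (fmap F d z)) /\ bijective th.
Proof.
move=> /bij_lin_inv[t [tK sK]].
have ex1 d : exists e : {linear SM -> SM}, forall z, e (sM z) = sM (fmap F d z).
  by exists (sM \o fmap F d \o t) => z; rewrite /= tK.
have ex2 (e : {linear SM -> SM}) : exists d : {linear M -> M},
    forall z, sM (fmap F d z) = e (sM z).
  have [d dE] := fmap_full eta eps (t \o e \o sM).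
  by exists d => z; rewrite dE /= sK.
have [th thE] := choice ex1; have [ht htE] := choice ex2.
exists th; split=> //; exists ht => d; apply: linear_ext => x.
  apply: (fmap_inj eta) x => z; apply: (can_inj tK).
  by rewrite htE thE.
by rewrite -[x]sK thE htE.
Qed.

Variables (M N : lmodType A) (P : proj_resolution M) (SM SN : lmodType B).
Variables (sM : {linear F M -> SM}) (sN : {linear F N -> SN}).
Hypotheses (simM : simple_mod M) (simSM : simple_mod SM).
Hypotheses (sMB : bijective sM) (sNB : bijective sN).
Variable x0 : SM.
Hypothesis nzx0 : x0 != 0.

(* Projectivity of F(P_0) is needed only along B -> SM; it follows from that of
   P_0, since the transpose G(B) -> M is onto by simplicity of M. *)
Lemma ext_lift : exists v : {linear F (res_mod P 0) -> B^o},
  forall z, (v z : B) *: x0 = sM (fmap F (res_aug P) z).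
Proof.
have [t [tK sK]] := bij_lin_inv sMB.
pose q : {linear B^o -> F M} := t \o mul_at x0.
have [e [eK Ke]] := bij_lin_inv (unit_bij eta M).
have onto : forall y, exists x, (e \o fmap G q) x = y.
  apply: simple_onto => //.
  have [|z nz] := @fmap_nz _ _ _ G _ eps _ _ q.
    exists 1; apply: contraNneq nzx0 => q1.
    by rewrite -[x0]sK -[x0]scale1r -mul_atE -[t _]/(q 1) q1 linear0.
  exists z; apply: contraNneq nz => ez.
  by rewrite -[fmap G q z]Ke -[e _]/((e \o fmap G q) z) ez linear0.
have [w wE] := res_projective (res_aug P) onto.
have [e' [eK' Ke']] := bij_lin_inv (unit_bij eta (res_mod P 0)).
have [v vE] := fmap_full eps eta (w \o e').
exists v => z.
have qv : q \o v =1 fmap F (res_aug P).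
  apply: (fmap_inj eps) => u; rewrite (fmap_comp q v) /= vE /=.
  rewrite -[LHS]Ke -[e _]/((e \o fmap G q) (w (e' u))) wE.
  by rewrite unit_nat Ke'.
by rewrite -qv /= sK.
Qed.

(* Both sides compute Ext^1 as Hom(kernel, N) modulo restrictions of maps from the
   middle term: for P_0 -> M, and for B -> SM with kernel the annihilator of [x0].
   Comparison maps u, v between the middle terms, over the simple module, give
   inverse isomorphisms because 1 - u v and 1 - v u land in the kernels. *)
Lemma ext_transport : exists Phi : (res_mod P 1 -> N) -> B -> SN,
  [/\ forall f, cocycle1 f -> ann_linear x0 (Phi f),
      forall f g b, cocycle1 f -> cocycle1 g -> b *: x0 = 0 ->
        Phi (f - g) b = Phi f b - Phi g b,
      forall f, cocycle1 f -> coboundary1 f <-> ann_cob x0 (Phi f),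
      forall h, ann_linear x0 h -> exists f, cocycle1 f /\
        ann_cob x0 (fun b => Phi f b - h b) &
      (forall thN : {linear N -> N} -> {linear SN -> SN},
        (forall d z, thN d (sN z) = sN (fmap F d z)) ->
        forall d f g b, cocycle1 f -> Ext1_lact d f g -> b *: x0 = 0 ->
          Phi g b = thN d (Phi f b)) /\
      (forall thM : {linear M -> M} -> {linear SM -> SM},
        (forall d z, thM d (sM z) = sM (fmap F d z)) ->
        forall d f g c, cocycle1 f -> Ext1_ract d f g -> c *: x0 = thM d x0 ->
          ann_cob x0 (fun b => Phi g b - Phi f (b * c)))].
Proof.
have [v vE] := ext_lift; have [del [delE onto]] := res_diff_onto P.
have [t [tK sK]] := bij_lin_inv sNB.
set aug := res_aug P; set inc := kernel_incl aug in delE.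
have incI : injective inc by apply: val_inj.
have FI : injective (fmap F inc) by apply: (kernel_fmap_inj eta eps).
(* [p0] defines the comparison map B -> F(P_0), b |-> b.p0, in the direction opposite to [v]. *)
have [p0 p0E] : exists p0, sM (fmap F aug p0) = x0.
  apply: (simple_onto (f := sM \o fmap F aug)) => //.
  have [|z nz] := @fmap_nz _ _ _ F _ eta _ _ aug.
    have [[x nzx] _] := simM; have [y yE] := res_surj P x.
    by exists y; rewrite yE.
  by exists z; rewrite /= -(linear0 sM) (inj_eq (bij_inj sMB)).
have ker0 z : sM (fmap F aug z) = 0 -> exists y, fmap F inc y = z.
  rewrite -(linear0 sM) => /(bij_inj sMB); exact: (kernel_fmap_ex eta eps).
(* Functions that are not cocycles get the zero map, so that [choice] yields a total function. *)
have barE f : exists g : {linear kernel aug -> N},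
    cocycle1 f -> forall x, g (del x) = f x.
  have [[fL f0]|nf] := EM (cocycle1 f); last first.
    by exists (lin (linearP (\0 : {linear kernel aug -> N}))).
  have [|g gE] := lin_quotient fL onto; last by exists g.
  move=> x dx; have /res_exact[y ->] : res_diff P 0 x = 0.
    by rewrite -delE dx linear0.
  exact: f0.
have {barE} [bar barE] := choice barE.
have bar_eq f (g : {linear kernel aug -> N}) : cocycle1 f ->
    (forall x, f x = g (del x)) -> forall z, bar f z = g z.
  by move=> fC fE z; have [x <-] := onto z; rewrite barE.
(* [u] is the comparison map b |-> b.p0 restricted to the annihilator and factored through F of the
   kernel; it is 0 elsewhere. *)
have uE b : exists z, b *: x0 = 0 -> fmap F inc z = b *: p0.
  have [bx|nb] := EM (b *: x0 = 0); last by exists 0.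
  have [|z zE] := ker0 (b *: p0); first by rewrite !linearZ /= p0E.
  by exists z.
have {uE} [u uE] := choice uE.
have uP a b c : b *: x0 = 0 -> c *: x0 = 0 -> u (a * b + c) = a *: u b + u c.
  move=> bx cx; apply: FI; rewrite linearP /= !uE //.
    by rewrite scalerDl scalerA.
  by rewrite scalerDl -scalerA bx scaler0 add0r.
pose Phi f b := sN (fmap F (bar f) (u b)).
exists Phi; split.
- by move=> f _ a b c bx cx; rewrite /Phi uP // !linearP.
- move=> f g b fC gC bx; rewrite /Phi -linearB; congr (sN _).
  apply: fmapB => z; have [x <-] := onto z.
  by rewrite !barE //; apply: cocycle1B.
- move=> f fC; split.
    case=> g gE; exists (sN (fmap F g p0)) => b bx.
    rewrite -!linearZ /= -uE // /Phi; congr (sN _).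
    by apply: fmap_eqcomp; apply: bar_eq (g \o inc) fC _ => x; rewrite gE -delE.
  case=> y yE.
  (* The identity minus z |-> v(z).p0 lands in F of the kernel, since [p0] lies over [x0]; [w] is
     its factorization. The extension of the cocycle is then bar f after [w], plus v(z).y: on the
     kernel [w] removes u(v z), and the second term restores its image. *)
  have [||w wE] := @lin_factor _ _ _ _ (fmap F inc) (idfun \- (mul_at p0 \o v)).
  + exact: FI.
  + move=> z; apply: ker0; rewrite /= /mul_elt !linearB /= !linearZ /=.
    by rewrite p0E scalerN vE subrr.
  have [g gE] := fmap_full eta eps ((fmap F (bar f) \o w) \+ (t \o mul_at y \o v)).
  exists g => x; rewrite -barE // -delE; move: (del x).
  apply: (fmap_inj eta (g := g \o inc)) => z; rewrite [RHS](fmap_comp g inc) /= gE /=.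
  set b := v _; have bx : b *: x0 = 0.
    by rewrite vE fmap_comp0 ?linear0 // => z'; apply: kernel_incl0.
  have -> : w (fmap F inc z) = z - u b.
    by apply: FI; rewrite wE linearB /= uE.
  have := yE b bx; rewrite /Phi => /(congr1 t); rewrite tK => <-.
  by rewrite linearB /= subrK.
- move=> h hL; have bz z : (v (fmap F inc z) : B) *: x0 = 0.
    by rewrite vE fmap_comp0 ?linear0 // => z'; apply: kernel_incl0.
  have hvL : linear (fun z => h (v (fmap F inc z))).
    by move=> a z z'; rewrite -hL // !linearP.
  have [g gE] := fmap_full eta eps (t \o lin hvL).
  have fC : cocycle1 (g \o del).
    split; first by move=> a x y; rewrite /= !linearP.
    move=> x /=; rewrite (_ : del _ = 0) ?linear0 //; apply: incI.
    by rewrite delE linear0; apply/res_exact; exists x.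
  (* [v p0 - 1] annihilates [x0]. Splitting b.v(p0) as b.(v p0 - 1) + b leaves the error b.h(v p0 -
     1), a coboundary. *)
  exists (g \o del); split=> //; exists (h (v p0 - 1)) => b bx.
  rewrite /Phi (fmap_eq (bar_eq _ g fC _)) // gE /= sK uE // linearZ /=.
  have vx : (v p0 - 1 : B) *: x0 = 0.
    by rewrite scalerBl scale1r vE p0E subrr.
  rewrite -[b *: v p0]/(b * (v p0 : B)).
  have {1}-> : b * (v p0 : B) = b * (v p0 - 1 : B) + b.
    by rewrite mulrBr mulr1 subrK.
  by rewrite hL // addrK.
- split.
  + move=> thN thE d f g b fC gE bx; rewrite /Phi thE; congr (sN _).
    apply: fmap_eqcomp; apply: bar_eq (d \o bar f) (Ext1_lact_cocycle fC gE) _.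
    by move=> x; rewrite gE /= barE.
  move=> thM thE d f g c fC gR cx; have gC := Ext1_ract_cocycle fC gR.
  have [d0 [d1 [d0E d1E gE]]] := gR.
  have [z|D DE] := @kernel_lift _ _ _ aug _ (d0 \o inc).
    by rewrite /= d0E kernel_incl0 linear0.
  (* The two terms lie over the same element thM(d)(x0), so they differ by some [om] from F of the
     kernel, whose image is the coboundary witness. *)
  have [|om omE] := ker0 (fmap F d0 p0 - c *: p0).
    rewrite !linearB /= [fmap F aug (c *: p0)]linearZ [sM (c *: _)]linearZ /=.
    rewrite p0E cx -[in thM _ _]p0E thE.
    rewrite -(@fmap_eqcomp _ _ _ F _ _ _ aug d0 (d \o aug)) //.
    by rewrite (fmap_comp d aug) subrr.
  exists (sN (fmap F (bar f) om)) => b bx.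
  have bcx : (b * c) *: x0 = 0 by rewrite -scalerA cx -linearZ /= bx linear0.
  rewrite /Phi (@fmap_eqcomp _ _ _ F _ _ _ (bar f) D); last first.
    apply: bar_eq (bar f \o D) gC _ => x; rewrite gE -barE //=; congr (bar f _).
    by apply: incI; rewrite delE d1E -delE DE.
  rewrite -!linearB -!linearZ /=; congr (sN _); congr (fmap F (bar f) _).
  apply: FI; rewrite linearB linearZ /= omE !uE //.
  rewrite -(@fmap_eqcomp _ _ _ F _ _ _ inc D (d0 \o inc)) //.
  by rewrite (fmap_comp d0 inc) /= uE // linearZ /= scalerBr scalerA.
Qed.
End ExtTransport.

(** * The layers of the radical *)

Section Layer.
Variables (k : fieldType) (A : falgType k) (s : nat) (W : top_dec A s).
Variables (i j : 'I_s).
Local Notation r := (rad W).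
Local Notation pi := (topi W).
Local Notation L := (layer W i j).

Lemma rad2_layer x : x \in (r * r)%VS -> x \in L.
Proof. by move=> x2; apply: (subvP (addvSr _ _)). Qed.

Lemma layer_prod p x q : pi p \in blk W i -> x \in r -> pi q \in blk W j ->
  p * x * q \in L.
Proof.
move=> pI xr qJ; apply: (subvP (addvSl _ _)).
by rewrite !memv_mul ?mem_blk_pre.
Qed.

Lemma layer_ind (S : A -> Prop) :
  (forall (c : k) x y, S x -> S y -> S (c *: x + y)) ->
  (forall x y, x \in r -> y \in r -> S (x * y)) ->
  (forall p x q, pi p \in blk W i -> x \in r -> pi q \in blk W j ->
    S (p * x * q)) ->
  forall x, x \in L -> S x.
Proof.
move=> SL Sr Sp.
have S0 : S 0 by rewrite -(mul0r 0); apply: Sr; rewrite mem0v.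
have [U UP] := vspace_of_pred S0 SL.
(* Spans of products unfold two factors at a time; [U'] collects the left parts whose products with
   the last factor stay in [U]. *)
have [U' U'P] : exists U' : {vspace A}, forall y, y \in U' <->
    forall q, q \in blk_pre W j -> y * q \in U.
  apply: vspace_of_pred => [q _|c x y xU yU q qj]; first by rewrite mul0r mem0v.
  by rewrite mulrDl -scalerAl memvD ?memvZ ?xU ?yU.
suff : (L <= U)%VS by move/subvP=> LU x /LU/UP.
rewrite subv_add; apply/andP; split; last first.
  by apply/prodvP=> x y xr yr; apply/UP/Sr.
apply/prodvP=> y q yU qj.
suff /subvP/(_ y yU)/U'P : (blk_pre W i * r <= U')%VS by apply.
apply/prodvP=> p x pI xr.
by apply/U'P=> q' q'j; apply/UP/Sp; rewrite // -mem_blk_pre.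
Qed.

Lemma layer_mul a x : x \in L -> a * x \in L /\ x * a \in L.
Proof.
move: x; apply: layer_ind => [c x y [ax xa] [ay ya]|x y xr yr|p x q pI xr qJ].
- rewrite mulrDl mulrDr -scalerAl -scalerAr.
  by split; rewrite memvD ?memvZ.
- split; first by apply: rad2_layer; rewrite mulrA memv_mul // rad_mull.
  by apply: rad2_layer; rewrite -mulrA memv_mul // rad_mulr.
- split.
    rewrite !mulrA; apply: layer_prod => //.
    by rewrite topiM; case: (blk_mul (pi a) pI).
  rewrite -(mulrA (p * x)); apply: layer_prod => //.
  by rewrite topiM; case: (blk_mul (pi a) qJ).
Qed.

Lemma layer_rad x : x \in L -> x \in r.
Proof.
move: x; apply: layer_ind => [c x y xr yr|x y xr yr|p x q _ xr _].
- by rewrite memvD ?memvZ.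
- exact: rad_mull.
- exact/rad_mulr/rad_mull.
Qed.

Lemma rad2_mulr x a : x \in (r * r)%VS -> x * a \in (r * r)%VS.
Proof.
move=> x2; have : (r * r * fullv <= r * r)%VS.
  by rewrite -prodvA prodvSr //; apply/prodvP=> y b yr _; apply: rad_mulr.
by move/prodvP; apply; rewrite ?memvf.
Qed.

Lemma rad_commutator a b x : pi a * pi b = pi b * pi a -> x \in r ->
  (a * b - b * a) * x \in (r * r)%VS.
Proof.
move=> ab xr; apply: memv_mul => //.
by rewrite mem_rad linearB /= !topiM ab subrr.
Qed.

(** On p.x.q the factor a.p - p lies in [r], as does x.q, so the error is in [r * r]; the right side
    is symmetric. *)
Lemma layer_fixed a b x : pi a = blk1 W i -> pi b = blk1 W j -> x \in L ->
  a * x - x \in (r * r)%VS /\ x * b - x \in (r * r)%VS.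
Proof.
move=> aE bE; move: x.
apply: layer_ind => [c x y [ax xb] [ay yb]|x y xr yr|p x q pI xr qJ].
- split; rewrite ?mulrDl ?mulrDr -?scalerAl -?scalerAr opprD addrACA -scalerBr;
  by rewrite memvD ?memvZ.
- have xy : x * y \in (r * r)%VS by apply: memv_mul.
  split; apply: memvB => //.
    by rewrite mulrA; apply: memv_mul => //; apply: rad_mull.
  by rewrite -(mulrA x); apply: memv_mul => //; apply: rad_mulr.
split.
  rewrite (_ : _ - _ = (a * p - p) * (x * q)); last first.
    by rewrite mulrBl !mulrA.
  apply: memv_mul; last exact: rad_mulr.
  by rewrite mem_rad linearB /= topiM aE blk1l ?subrr.
rewrite (_ : _ - _ = p * x * (q * b - q)); last by rewrite mulrBr !mulrA.
apply: memv_mul; first exact: rad_mull.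
by rewrite mem_rad linearB /= topiM bE blk1r ?subrr.
Qed.

(* [g] represents a morphism from the layer modulo [r * r] to [N]; its values
   outside the layer are irrelevant. *)
Definition layer_hom (N : lmodType A) (g : A -> N) :=
  (forall a x y, x \in L -> y \in L -> g (a * x + y) = a *: g x + g y) /\
  (forall x, x \in (r * r)%VS -> g x = 0).

Lemma layer_hom_eq (N : lmodType A) (g : A -> N) x y :
  layer_hom g -> y \in L -> x - y \in (r * r)%VS -> g x = g y.
Proof.
move=> [gL g0] yL xy; have := gL 1 (x - y) y (rad2_layer xy) yL.
by rewrite mul1r subrK scale1r (g0 _ xy) add0r.
Qed.

Variables (M N : lmodType A) (Mj : simple_at W j M) (Ni : simple_at W i N).
Variables (x0 : M) (nzx0 : x0 != 0).

Lemma rad_ann x : x \in r -> x *: x0 = 0.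
Proof. by move=> xr; apply: (simple_rad _ _ xr); case: Mj. Qed.

Lemma ann_linear0 h : ann_linear x0 h -> h 0 = 0 :> N.
Proof.
move=> hL; have := hL 1 0 0 (scale0r _) (scale0r _).
by rewrite mulr0 addr0 scale1r => /esym/(canRL (addrK _)); rewrite subrr.
Qed.

Lemma ann_linearZ h a b : ann_linear x0 h -> b *: x0 = 0 ->
  h (a * b) = a *: h b :> N.
Proof.
move=> hL bx; have := hL a b 0 bx (scale0r _).
by rewrite ann_linear0 // !addr0.
Qed.

(** On a product, h(y.z) = y.h(z), and [y] in the radical kills the simple module [N]. *)
Lemma ann_linear_rad2 h x : ann_linear x0 h -> x \in (r * r)%VS -> h x = 0 :> N.
Proof.
move=> hL; have [U UP] : exists U : {vspace A},
    forall y, y \in U <-> y \in r /\ h y = 0.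
  apply: vspace_of_pred; first by rewrite mem0v ann_linear0.
  move=> c y z [yr hy] [zr hz]; split; first by rewrite memvD ?memvZ.
  rewrite -[c *: y]mulr_algl hL ?hy ?hz ?scaler0 ?addr0 //; exact: rad_ann.
suff : (r * r <= U)%VS by move/subvP=> rU /rU/UP[].
apply/prodvP=> y z yr zr; apply/UP; split; first exact: rad_mull.
rewrite ann_linearZ //; last exact: rad_ann.
by apply: (simple_rad _ _ yr); case: Ni.
Qed.

Lemma ann_linear_layer h : ann_linear x0 h -> layer_hom (h : A -> N).
Proof.
move=> hL; split=> [a x y xL yL|x]; last exact: ann_linear_rad2.
by apply: hL; apply/rad_ann/layer_rad.
Qed.

Lemma ann_cob_layer h : ann_cob x0 (h : A -> N) -> forall x, x \in r -> h x = 0.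
Proof.
move=> [y yE] x xr; rewrite yE ?rad_ann //.
by apply: (simple_rad _ _ xr); case: Ni.
Qed.

(* Modulo [r], [c] is an idempotent with the same left annihilator as [x0]. *)
Variable c : A.
Hypotheses (cj : pi c \in blk W j) (cx : c *: x0 = x0).
Hypothesis cr : forall a, a *: x0 = 0 -> a * c \in r.

(** This is the injectivity of restriction to the layer, on classes modulo coboundaries. *)
Lemma ann_cobP h : ann_linear x0 h -> (forall x, x \in L -> h x = 0 :> N) ->
  ann_cob x0 h.
Proof.
move=> hL h0; set d := 1 - c.
have dx : d *: x0 = 0 by rewrite scalerBl scale1r cx subrr.
have [e eE] := topi_ex (blk1 W i).
exists (h d + c *: h d) => b bx; have bcr := cr bx.
have bccr : b * c * c \in r by apply: rad_mulr.
(* The first two terms are multiples of [d], hence give a coboundary. Splitting [b * c] once more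
   leaves a right factor [c] in the last term, which becomes a layer element after multiplication by
   [e], and [e] acts as the identity on [N]. *)
have bE : b = b * d + (b * c * d + b * c * c).
  by rewrite -mulrDr subrK mulr1 -mulrDr subrK mulr1.
have bccx := rad_ann bccr.
have bcx : (b * c * d + b * c * c) *: x0 = 0.
  by rewrite scalerDl -(scalerA (b * c)) dx scaler0 add0r.
rewrite {1}bE (hL _ _ _ dx bcx) (hL _ _ _ dx bccx).
rewrite scalerDr scalerA addrA -[h (b * c * c)](simple_at1 _ Ni eE).
rewrite -(ann_linearZ e hL bccx) (h0 (e * _)) ?addr0 //.
rewrite (mulrA e); apply: layer_prod => //.
by rewrite eE blk1_in.
Qed.

(** Right multiplication by [c] carries the annihilator into [r]. The lift [e] commutes with [a]
    only modulo [r], but the resulting error is in [r * r], which [g] kills. *)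
Lemma layer_hom_ann (g : A -> N) e p : layer_hom g -> pi e = blk1 W i ->
  pi p \in blk W j -> ann_linear x0 (fun a => g (e * (a * c) * p)).
Proof.
move=> gH eE pj a b b' bx b'x.
have [gL g0] := gH; have ei : pi e \in blk W i by rewrite eE blk1_in.
have bL : e * (b * c) * p \in L by apply: layer_prod => //; apply: cr.
have b'L : e * (b' * c) * p \in L by apply: layer_prod => //; apply: cr.
rewrite -gL //; apply: layer_hom_eq => //.
  by rewrite memvD //; case: (layer_mul a bL).
rewrite mulrDl mulrDr mulrDl opprD addrACA subrr addr0.
rewrite (_ : _ - _ = (e * a - a * e) * (b * c) * p); last first.
  by rewrite !mulrBl !mulrA.
rewrite -(mulrA _ _ p); apply: rad_commutator; last exact/rad_mulr/cr.
by rewrite eE blk1_comm.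
Qed.
End Layer.

(** * Nonvanishing of extensions and of the layer *)

Section ExtLayer.
Variables (k : fieldType) (A : falgType k) (s : nat) (W : top_dec A s).
Variables (i j : 'I_s) (M N : lmodType A).
Hypotheses (Mj : simple_at W j M) (Ni : simple_at W i N).
Local Notation r := (rad W).
Local Notation pi := (topi W).
Local Notation L := (layer W i j).

Lemma maximal_sublayer : L != (r * r)%VS -> exists J : {vspace A},
  [/\ left_ideal J, (r * r <= J)%VS, (J <= L)%VS, J != L &
      forall z, z \in L -> z \notin J -> (J + fullv * <[z]>)%VS = L].
Proof.
move=> nLr; pose P d := exists J : {vspace A},
  [/\ left_ideal J, (r * r <= J)%VS, (J <= L)%VS, J != L & \dim J = d].
have rL : (r * r <= L)%VS by apply: addvSr.
have exP : exists d, `[< P d >].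
  exists (\dim (r * r)); apply/asboolP; exists (r * r)%VS.
  split=> //; last by rewrite eq_sym.
  rewrite /left_ideal prodvA prodvSl //; apply/prodvP=> a x _; exact: rad_mull.
have ubP d : `[< P d >] -> (d <= \dim {:A})%N.
  by case/asboolP=> J [_ _ _ _ <-]; apply/dimvS/subvf.
case: (ex_maxnP exP ubP) => d /asboolP[J [lJ rJ JL nJL dJ]] maxd.
exists J; split=> // z zL zJ; apply/eqP; apply: contraT => nJz.
have zLL : (fullv * <[z]> <= L)%VS.
  by apply/subvP=> _ /memv_cosetP[a _ ->]; case: (layer_mul a zL).
suff : (\dim (J + fullv * <[z]>) <= \dim J)%N.
  rewrite (geq_leqif (dimv_leqif_sup (addvSl J _))) => /subvP JzJ.
  case/negP: zJ; apply: JzJ; apply: (subvP (addvSr _ _)).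
  by apply/memv_cosetP; exists 1; rewrite ?memvf ?mul1r.
rewrite [leqRHS]dJ; apply: maxd; apply/asboolP; exists (J + fullv * <[z]>)%VS.
split=> //.
- rewrite /left_ideal prodvDr addvS // prodvA prodvSl // subvf //.
- exact: subv_trans (addvSl _ _).
- by rewrite subv_add JL.
Qed.

(** A simple quotient L / J belongs to block i, whose unit acts as the identity on the layer from
    the left. It therefore maps isomorphically to [N]. *)
Lemma layer_hom_ex : L != (r * r)%VS ->
  exists (g : A -> N) x, [/\ layer_hom W i j g, x \in L & g x != 0].
Proof.
move=> /maximal_sublayer[J [/left_idealP lJ rJ JL nJL maxJ]].
have [e ePI] := primitive_idem_ex W i; have [ei nze _ eV] := ePI.
have [c cE] := topi_ex e; have [y [nzy cy]] := primitive_fixed ePI cE Ni.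
have ann a := primitive_ann ePI cE a Ni nzy cy.
have /choice[l lE] := topi_ex (W := W).
(* Otherwise [J] contains b.z for a lift [b] of the block unit, since that unit is a sum of products
   through [e]; and z - b.z is in [r * r]. *)
have [z0 [z0L nz]] : exists z0, z0 \in L /\ c * z0 \notin J.
  apply: contra_notP (elimN eqP nJL) => no; apply/eqP; rewrite eqEsubv JL /=.
  apply/subvP=> z zL; have [q qE] := blk_gen ei nze.
  pose b := \sum_(p <- q) l p.1 * c * l p.2.
  have bE : pi b = blk1 W i.
    by rewrite linear_sum qE; apply: eq_bigr => p _ /=; rewrite !topiM !lE cE.
  have [bj bjE] := topi_ex (blk1 W j).
  have [bz _] := layer_fixed bE bjE zL.
  rewrite -[z](subKr (b * z)) memvB ?(subvP rJ _ bz) //.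
  rewrite mulr_suml memv_suml // => p _; rewrite -!mulrA; apply: lJ.
  apply/negPn/negP=> nJ; apply: no; exists (l p.2 * z); split=> //.
  by case: (layer_mul (l p.2) zL).
pose z := c * z0; have zL : z \in L by case: (layer_mul c z0L).
have z0r := layer_rad z0L.
(* If pi(a).e were nonzero, some [t] would give t.pi(a).e = e, and [z] would differ from an element
   of [J] by one of [r * r]. *)
have wd a : a * z \in J -> a *: y = 0.
  move=> azJ; apply/ann/eqP; apply: contraNT nz => /eV[t tE].
  have rJ' : (l t * a * c - c) * z0 \in J.
    apply: (subvP rJ); apply: memv_mul => //.
    by rewrite mem_rad linearB /= !topiM lE cE -mulrA tE subrr.
  rewrite -/z -(subKr (l t * (a * z)) z); apply: memvB; first exact: lJ.
  by rewrite /z !mulrA -mulrBl.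
have ex_a x : exists a, x \in L -> x - a * z \in J.
  have [xL|nx] := boolP (x \in L); last by exists 0.
  have := xL; rewrite -(maxJ z zL nz) => /memv_addP[u uJ [_ /memv_cosetP[a _ ->] ->]].
  by exists a; rewrite addrK.
have [f fE] := choice ex_a; exists (fun x => f x *: y), z.
have gE x a : x \in L -> x - a * z \in J -> f x *: y = a *: y.
  move=> xL xa; apply/eqP; rewrite -subr_eq0 -scalerBl; apply/eqP/wd.
  rewrite (_ : _ * z = (x - a * z) - (x - f x * z)); last first.
    by rewrite mulrBl opprB [RHS]addrC addrA subrK.
  by apply: memvB => //; apply: fE.
split=> //; first split=> [a x x' xL x'L|x x2].
- rewrite scalerA -scalerDl; apply: gE.
    by apply: memvD => //; case: (layer_mul a xL).
  by rewrite mulrDl opprD addrACA -mulrA -mulrBr memvD ?lJ ?fE.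
- rewrite (gE x 0) ?scale0r ?rad2_layer // mul0r subr0.
  exact: (subvP rJ).
by rewrite (gE z 1) ?scale1r // mul1r subrr mem0v.
Qed.

Lemma ext_layer : exists2 x0 : M, x0 != 0 &
  (exists h : A -> N, ann_linear x0 h /\ ~ ann_cob x0 h) <-> L != (r * r)%VS.
Proof.
have [e ePI] := primitive_idem_ex W j; have [ej nze ee _] := ePI.
have [c cE] := topi_ex e; have [x0 [nzx0 cx]] := primitive_fixed ePI cE Mj.
have ann a := primitive_ann ePI cE a Mj nzx0 cx.
have cr a : a *: x0 = 0 -> a * c \in r.
  by move/ann=> ae; rewrite mem_rad topiM cE ae.
have cj : pi c \in blk W j by rewrite cE.
exists x0 => //; split=> [[h [hL nh]]|].
  apply/eqP=> Lr; apply: nh; apply: (ann_cobP Mj Ni cj cx cr hL) => x.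
  by rewrite Lr => /(ann_linear_rad2 Mj Ni hL).
move/layer_hom_ex=> [g [x [gH xL /eqP nzg]]]; have [gL g0] := gH.
have [b bE] := topi_ex (blk1 W i); have [d dE] := topi_ex (blk1 W j).
apply: contrapT => no; apply: nzg.
have /choice[l lE] := topi_ex (W := W).
have cpj p : pi (c * p) \in blk W j.
  by rewrite topiM; case: (blk_mul (pi p) cj).
(* If all annihilator maps were coboundaries, those built from [g] would vanish on [r]. *)
have gr a p : a \in r -> g (b * (a * c) * (c * p)) = 0.
  move=> ar; pose h a := g (b * (a * c) * (c * p)); rewrite -[LHS]/(h a).
  have hL : ann_linear x0 h by apply: (layer_hom_ann cr gH bE (cpj p)).
  apply: (ann_cob_layer (x0 := x0) Mj Ni _ ar); apply: contrapT => nh.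
  by apply: no; exists h.
have [q qE] := blk_gen ej nze.
(* The sum of the [p.1 * e * p.2] is the block unit and [e] is idempotent, so [y] agrees with
   [b * x * d], hence with [x], modulo [r * r]. *)
pose y := \sum_(p <- q) b * (x * l p.1 * c) * (c * l p.2).
have xr := layer_rad xL; have bi : pi b \in blk W i by rewrite bE blk1_in.
have [yL gy] : y \in L /\ g y = 0.
  apply: (big_ind (fun y => y \in L /\ g y = 0)).
  - by split; [apply: mem0v | apply: g0; apply: mem0v].
  - move=> u v [uL gu] [vL gv]; split; first exact: memvD.
    by have := gL 1 u v uL vL; rewrite mul1r gu gv scaler0 addr0.
  - move=> p _; split; last by apply: gr; apply: rad_mulr.
    by apply: layer_prod => //; apply/rad_mulr/rad_mulr.
rewrite (layer_hom_eq gH yL) //.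
have [bx _] := layer_fixed bE dE xL.
have [bxL _] := layer_mul b xL; have [_ bxd] := layer_fixed bE dE bxL.
have bxy : b * x * d - y \in (r * r)%VS.
  pose y' := \sum_(p <- q) l p.1 * c * (c * l p.2).
  have -> : b * x * d - y = b * x * (d - y').
    rewrite mulrBr; congr (_ - _); rewrite mulr_sumr.
    by apply: eq_bigr => p _; rewrite !mulrA.
  apply: memv_mul; first exact: rad_mull.
  rewrite mem_rad linearB /= dE linear_sum qE subr_eq0; apply/eqP/eq_bigr=> p _.
  by rewrite /= !topiM !lE cE -!mulrA (mulrA e e) ee.
rewrite -(subrK (b * x * d) x) -addrA memvD // -memvN opprB.
by rewrite -(subrK (b * x) (b * x * d)) -addrA memvD.
Qed.
End ExtLayer.

(** * Free bimodules *)

Import passmx.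

Section FreeBimodule.
Variables (k : fieldType) (R S : falgType k) (t : nat).
Implicit Types (x a : R) (y b : S) (z : free_bimod R S t).
Local Notation e := (vbasis {:R}).
Local Notation f := (vbasis {:S}).

(** R (x) S is a free left R-module on the 1 (x) f_q, for f the basis of S; this is the coordinate
    at f_q. *)
Definition tensor_coef (z : tensor R S) (q : 'I_(\dim {:S})) : R :=
  vecof e (col q z)^T.

Lemma tensor_coef_linear q : linear (tensor_coef^~ q).
Proof. by move=> c z z'; rewrite /tensor_coef !linearP. Qed.

Lemma tensor_coef_lact a w q :
  tensor_coef (tensor_lact a w) q = a * tensor_coef w q.
Proof.
rewrite /tensor_coef /tensor_lact colE -mulmxA -colE trmx_mul trmxK.
by rewrite mul_mxof rVofK ?vbasisP // lfunE.
Qed.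

Lemma tensor_coef_tens x y q : tensor_coef (tens x y) q = coord f q y *: x.
Proof.
rewrite /tensor_coef -[in RHS](rVofK (vbasisP _) x) -linearZ /=; congr vecof.
by apply/rowP=> p; rewrite !mxE big_ord1 !mxE mulrC.
Qed.

Lemma tens_span (z : tensor R S) : z = \sum_q tens (tensor_coef z q) f`_q.
Proof.
apply/matrixP=> p q; rewrite summxE (bigD1 q) //= big1 => [|q' nq].
  by rewrite /tens rVofE ?vbasisP // vecofK ?vbasisP // mxE big_ord1 !mxE
    !eqxx mulr1 addr0.
by rewrite /tens rVofE ?vbasisP // mxE big_ord1 !mxE [q == _]eq_sym (negPf nq) andbF
  mulr0.
Qed.

Lemma tens_linear x : linear (tens x : S -> tensor R S).
Proof. by move=> c y y'; rewrite /tens linearP mulmxDr -scalemxAr. Qed.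

Lemma tensor_lact_tens a x y : tensor_lact a (tens x y) = tens (a * x) y.
Proof.
rewrite /tensor_lact /tens mulmxA -trmx_mul.
by rewrite mul_mxof rVofK ?vbasisP // lfunE.
Qed.

Lemma tensor_ract_tens x y b : tensor_ract (tens x y) b = tens x (y * b).
Proof.
by rewrite /tensor_ract /tens -mulmxA mul_mxof rVofK ?vbasisP // lfunE.
Qed.

Lemma tensor_lact_linear a : linear (@tensor_lact _ R S a).
Proof. by move=> c z z'; rewrite /tensor_lact mulmxDr -scalemxAr. Qed.

Lemma tensor_ract_linear b : linear ((@tensor_ract _ R S)^~ b).
Proof. by move=> c z z'; rewrite /tensor_ract mulmxDl -scalemxAl. Qed.

Lemma free_ract1 z : free_ract z 1 = z.
Proof.
apply/ffunP=> l; rewrite ffunE [z l in LHS]tens_span.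
rewrite -[tensor_ract _ _]/(lin (tensor_ract_linear 1) _) linear_sum /=.
rewrite [RHS]tens_span; apply: eq_bigr => q _.
by rewrite tensor_ract_tens mulr1.
Qed.

Lemma free_lact1 z : free_lact 1 z = z.
Proof.
apply/ffunP=> l; rewrite ffunE [z l in LHS]tens_span.
rewrite -[tensor_lact _ _]/(lin (tensor_lact_linear 1) _) linear_sum /=.
rewrite [RHS]tens_span; apply: eq_bigr => q _.
by rewrite tensor_lact_tens mul1r.
Qed.

Definition free_gen (l : 'I_t) y : free_bimod R S t :=
  [ffun l' => if l' == l then tens 1 y else 0].

Lemma free_gen_linear l : linear (free_gen l).
Proof.
move=> c y y'; apply/ffunP=> l'; rewrite !ffunE; case: eqP => _.
  exact: tens_linear.
by rewrite scaler0 addr0.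
Qed.

Lemma free_gen_ract l y b : free_ract (free_gen l y) b = free_gen l (y * b).
Proof.
apply/ffunP=> l'; rewrite !ffunE; case: eqP => _; first exact: tensor_ract_tens.
exact: (linear0 (lin (tensor_ract_linear b))).
Qed.

Lemma free_gen_span z :
  z = \sum_l \sum_q free_lact (tensor_coef (z l) q) (free_gen l f`_q).
Proof.
apply/ffunP=> l; rewrite sum_ffunE (bigD1 l) //= [X in _ + X]big1 => [|l' nl].
  rewrite addr0 sum_ffunE [LHS]tens_span; apply: eq_bigr => q _.
  by rewrite !ffunE eqxx tensor_lact_tens mulr1.
rewrite sum_ffunE big1 // => q _; rewrite !ffunE [l == _]eq_sym (negPf nl).
exact: (linear0 (lin (tensor_lact_linear _))).
Qed.

(* Left R-linear maps from t copies of R (x)_k S to R are the same as t-tuples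
   of k-linear maps from S to R. *)
Definition free_ext (v : 'I_t -> 'Hom(S, R)) z : R :=
  \sum_l \sum_q tensor_coef (z l) q * v l f`_q.

Lemma free_ext_linear v : linear (free_ext v).
Proof.
move=> c z z'; rewrite scaler_sumr -big_split; apply: eq_bigr => l _ /=.
rewrite scaler_sumr -big_split; apply: eq_bigr => q _ /=.
by rewrite !ffunE tensor_coef_linear mulrDl scalerAl.
Qed.

Lemma free_ext_lact v a z : free_ext v (free_lact a z) = a * free_ext v z.
Proof.
rewrite mulr_sumr; apply: eq_bigr => l _; rewrite mulr_sumr.
by apply: eq_bigr => q _; rewrite ffunE tensor_coef_lact mulrA.
Qed.

Lemma free_ext_gen v l y : free_ext v (free_gen l y) = v l y.
Proof.
rewrite /free_ext (bigD1 l) //= [X in _ + X]big1 => [|l' nl].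
  rewrite addr0 [y in RHS](coord_vbasis (memvf y)) linear_sum.
  apply: eq_bigr => q _; rewrite ffunE eqxx tensor_coef_tens linearZ /=.
  by rewrite -scalerAl mul1r.
rewrite big1 // => q _; rewrite ffunE (negPf nl).
have -> : tensor_coef (0 : tensor R S) q = 0.
  exact: (linear0 (lin (tensor_coef_linear q))).
exact: mul0r.
Qed.
End FreeBimodule.

(** * Basic algebras *)

Section Basic.
Variables (k : fieldType) (A : falgType k) (s : nat) (W : top_dec A s).
Implicit Types (i j : 'I_s).
Local Notation r := (rad W).
Local Notation pi := (topi W).
Local Notation F i := (subvs_of (blk W i)).

(** Multiplication by a central idempotent makes this an algebra morphism onto the block. *)
Definition proj_blk i (a : A) : F i := vsproj (blk W i) (pi a * blk1 W i).

Lemma proj_blk_val i a : vsval (proj_blk i a) = pi a * blk1 W i.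
Proof. by rewrite vsprojK //; case: (blk_mul (pi a) (blk1_in W i)). Qed.

Lemma proj_blk_linear i : linear (proj_blk i).
Proof. by move=> c a b; rewrite /proj_blk linearP /= mulrDl -scalerAl linearP. Qed.

Lemma proj_blkM i a b : proj_blk i (a * b) = proj_blk i a * proj_blk i b.
Proof.
apply: val_inj; rewrite /= !proj_blk_val topiM -!mulrA; congr (_ * _).
by rewrite [RHS]mulrA -blk1_comm -mulrA blk1_idem.
Qed.

Lemma proj_blkE i a (u : F i) : pi a = vsval u -> proj_blk i a = u.
Proof.
by move=> aE; apply: val_inj; rewrite /= proj_blk_val aE blk1r ?subvsP.
Qed.

Lemma proj_blk1 i a : pi a = blk1 W i -> proj_blk i a = 1.
Proof. by move=> aE; apply: proj_blkE. Qed.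

Lemma proj_blk_eq0 i a : proj_blk i a = 0 <-> pi a * blk1 W i = 0.
Proof.
rewrite -proj_blk_val; split=> [->|a0]; first exact: linear0.
by apply: val_inj; rewrite /= a0.
Qed.

Lemma proj_blk_ex i (u : F i) : exists a, proj_blk i a = u.
Proof. by have [a /proj_blkE] := topi_ex (vsval u); exists a. Qed.

Hypothesis basW : basic_alg W.

(** A nonzero component of [a] is invertible, and a lift [b] of its inverse makes [b * a] act as the
    identity on [N]. *)
Lemma basic_ann i (N : lmodType A) (y : N) a : simple_at W i N -> y != 0 ->
  a *: y = 0 <-> proj_blk i a = 0.
Proof.
move=> Ni nzy; split=> [ay|/proj_blk_eq0/(simple_at0 y Ni) //].
apply/eqP; apply: contraT => /basW au.
have [b bE] := proj_blk_ex (proj_blk i a)^-1; have [c cE] := topi_ex (blk1 W i).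
case/eqP: nzy; rewrite -(simple_at1 y Ni cE) -(subKr (b * a) c) scalerBl.
rewrite -scalerA ay scaler0 sub0r (simple_at0 y Ni) ?oppr0 //.
apply/proj_blk_eq0; rewrite -[LHS]/(lin (proj_blk_linear i) _) linearB /=.
by rewrite proj_blkM bE mulVr // (proj_blk1 cE) subrr.
Qed.

Lemma basic_coord i (N : lmodType A) (y : N) : simple_at W i N -> y != 0 ->
  exists psi : N -> F i,
    (forall a, psi (a *: y) = proj_blk i a) /\ bijective psi.
Proof.
move=> Ni nzy; have ann a := basic_ann a Ni nzy.
have gen := simple_gen (proj1 Ni) nzy; have [g gE] := choice gen.
have wd a b : proj_blk i a = proj_blk i b <-> a *: y = b *: y.
  have := ann (a - b).
  rewrite -[proj_blk i _]/(lin (proj_blk_linear i) _) linearB /= scalerBl.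
  move=> [ab ba]; split=> /eqP; rewrite -subr_eq0 => /eqP.
    by move/ba/eqP; rewrite subr_eq0 => /eqP.
  by move/ab/eqP; rewrite subr_eq0 => /eqP.
exists (proj_blk i \o g); split=> [a|]; first by apply/wd; rewrite -gE.
have [l lE] := choice (@proj_blk_ex i).
exists (fun u => l u *: y) => [x|u] /=; first by rewrite [RHS]gE; apply/wd; rewrite lE.
by rewrite -[RHS]lE; apply/wd; rewrite -gE.
Qed.

Section Coord.
Variables (i : 'I_s) (N : lmodType A) (y : N) (psi : N -> F i).
Hypotheses (Ni : simple_at W i N) (nzy : y != 0).
Hypotheses (psiE : forall a, psi (a *: y) = proj_blk i a) (psiB : bijective psi).

Lemma coord_scale a x : psi (a *: x) = proj_blk i a * psi x.
Proof.
have [b ->] := simple_gen (proj1 Ni) nzy x.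
by rewrite scalerA !psiE proj_blkM.
Qed.

Lemma coordD x x' : psi (x + x') = psi x + psi x'.
Proof.
have [b ->] := simple_gen (proj1 Ni) nzy x.
have [b' ->] := simple_gen (proj1 Ni) nzy x'.
rewrite -scalerDl !psiE -[LHS]/(lin (proj_blk_linear i) _) linearD.
by [].
Qed.

Lemma coord0 : psi 0 = 0.
Proof. by have := coordD 0 0; rewrite addr0 => /esym/(canRL (addrK _)); rewrite subrr. Qed.

Lemma coordB x x' : psi (x - x') = psi x - psi x'.
Proof.
apply/eqP; rewrite -subr_eq0 opprB addrA -coordD subrK.
by rewrite subrr.
Qed.

Lemma coord_eq0 x : psi x = 0 <-> x = 0.
Proof.
by split=> [x0|->]; [apply: (bij_inj psiB); rewrite coord0 | exact: coord0].
Qed.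

Lemma proj_blk_alg (c : k) : proj_blk i c%:A = c%:A.
Proof.
rewrite -[LHS]/(lin (proj_blk_linear i) _) linearZ /=; congr (_ *: _).
by apply: val_inj; rewrite /= proj_blk_val topi1 mul1r.
Qed.

Lemma coordZ (c : k) x : psi (c%:A *: x) = c *: psi x.
Proof. by rewrite coord_scale proj_blk_alg mulr_algl. Qed.

(** With [N] identified with F_i, endomorphisms are right multiplications; this is the multiplier,
    the image of the generator. *)
Definition end_coord (d : {linear N -> N}) : F i := psi (d y).

Lemma end_coordE (d : {linear N -> N}) x : psi (d x) = psi x * end_coord d.
Proof.
have [a ->] := simple_gen (proj1 Ni) nzy x.
by rewrite linearZ /= coord_scale psiE.
Qed.

Lemma end_coord_bij : bijective end_coord.
Proof.
have [phi phiK psiK] := psiB.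
have ex u : exists d : {linear N -> N}, forall x, d x = phi (psi x * u).
  have dL : linear (fun x => phi (psi x * u)).
    move=> a x x'; apply: (can_inj phiK); rewrite psiK !coordD !coord_scale.
    by rewrite !psiK mulrDl mulrA.
  by exists (lin dL).
have [h hE] := choice ex; exists h => [d|u].
  by apply: linear_ext => x; rewrite hE -end_coordE phiK.
have [e eE] := topi_ex (blk1 W i).
rewrite /end_coord hE psiK -[y](simple_at1 y Ni eE) psiE (proj_blk1 eE).
exact: mul1r.
Qed.
End Coord.
End Basic.

Section LayerCoord.
Variables (k : fieldType) (A : falgType k) (s : nat) (W : top_dec A s).
Variables (i j : 'I_s) (m : nat).
Local Notation r := (rad W).
Local Notation pi := (topi W).
Local Notation F i := (subvs_of (blk W i)).
Local Notation L := (layer W i j).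
Variable phi : 'Hom(A, free_bimod (F i) (F j) m).
Hypothesis phi_onto : (phi @: L = fullv)%VS.
Hypothesis phi_ker : (L :&: lker phi = r * r)%VS.
Hypothesis phi_act : forall (u : F i) (v : F j) (a x b : A),
  pi a = vsval u -> pi b = vsval v -> x \in L ->
  phi (a * x * b) = free_lact u (free_ract (phi x) v).

Lemma phi_rad2 x : x \in (r * r)%VS -> phi x = 0.
Proof. by rewrite -phi_ker => /memv_capP[_]; rewrite memv_ker => /eqP. Qed.

Lemma phi_eq x y : x \in L -> y \in L ->
  phi x = phi y <-> x - y \in (r * r)%VS.
Proof.
move=> xL yL; split=> [xy|/phi_rad2/eqP].
  by rewrite -phi_ker memv_cap memvB // memv_ker linearB /= xy subrr /=.
by rewrite linearB /= subr_eq0 => /eqP.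
Qed.

Lemma phi_ex z : exists x, x \in L /\ phi x = z.
Proof. by have := memvf z; rewrite -phi_onto => /memv_imgP[x xL ->]; exists x. Qed.

(** The hypothesis on [phi] concerns lifts of block elements on both sides. A general [a] is
    replaced by a lift of its block component, with a lift of the block unit on the right; the error
    is in [r * r]. *)
Lemma phi_mull a x : x \in L -> phi (a * x) = free_lact (proj_blk W i a) (phi x).
Proof.
move=> xL; have [axL _] := layer_mul a xL.
have [a' a'E] := topi_ex (vsval (proj_blk W i a)).
have [e eE] := topi_ex (blk1 W i); have [b bE] := topi_ex (blk1 W j).
rewrite -[phi x]free_ract1 -(phi_act a'E _ xL (b := b)) //.
have [eax _] := layer_fixed eE bE axL; have [eaxL _] := layer_mul e axL.
have [_ eaxb] := layer_fixed eE bE eaxL.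
apply/esym/phi_eq => //.
  by have [a'xL _] := layer_mul a' xL; have [] := layer_mul b a'xL.
have -> : a' * x * b - a * x = (a' - e * a) * (x * b) +
    ((e * (a * x) * b - e * (a * x)) + (e * (a * x) - a * x)).
  by rewrite mulrBl !mulrA !addrA !subrK.
apply: memvD; last exact: memvD.
apply: memv_mul; last exact/rad_mulr/layer_rad/xL.
rewrite mem_rad linearB /= topiM a'E proj_blk_val eE.
by rewrite blk1_comm subrr.
Qed.

Lemma phi_mulr b x : x \in L -> phi (x * b) = free_ract (phi x) (proj_blk W j b).
Proof.
move=> xL; have [_ xbL] := layer_mul b xL.
have [b' b'E] := topi_ex (vsval (proj_blk W j b)).
have [e eE] := topi_ex (blk1 W i); have [d dE] := topi_ex (blk1 W j).
have [ex _] := layer_fixed eE dE xL.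
have [_ xbd] := layer_fixed eE dE xbL; have [exL _] := layer_mul e xL.
rewrite -[RHS]free_lact1 -(phi_act (a := e) _ b'E xL) //.
apply/esym/phi_eq => //; first by case: (layer_mul b' exL).
have -> : e * x * b' - x * b = e * x * (b' - b * d) +
    ((e * x - x) * (b * d) + (x * b * d - x * b)).
  by rewrite mulrBl mulrBr !mulrA !addrA !subrK.
apply: memvD.
  apply: memv_mul; first exact/rad_mull/layer_rad/xL.
  by rewrite mem_rad linearB /= topiM b'E proj_blk_val dE subrr.
by apply: memvD => //; apply: rad2_mulr.
Qed.

Section Coord.
Variables (N : lmodType A) (y : N) (psi : N -> F i).
Hypotheses (Ni : simple_at W i N) (nzy : y != 0).
Hypotheses (psiE : forall a, psi (a *: y) = proj_blk W i a) (psiB : bijective psi).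

(** Modulo [r * r] the layer is [m] copies of F_i (x) F_j. A left linear map to F_i is freely
    prescribed on the generators 1 (x) u of each copy, k-linearly in u; [free_ext] gives the inverse
    construction. *)
Lemma layer_coord : exists Psi : (A -> N) -> {ffun 'I_m -> 'Hom(F j, F i)},
  [/\ forall g, layer_hom W i j g -> forall l u x, x \in L ->
        phi x = free_gen (F i) l u -> Psi g l u = psi (g x),
      forall v, exists2 g, layer_hom W i j g & Psi g = v &
      forall g, layer_hom W i j g ->
        (forall x, x \in L -> g x = 0) <-> Psi g = 0].
Proof.
have [X XE] := choice phi_ex.
have XL z : X z \in L by case: (XE z).
have phiX z : phi (X z) = z by case: (XE z).
have gX (g : A -> N) x z : layer_hom W i j g -> x \in L -> phi x = z -> g x = g (X z).
  by move=> gH xL xz; apply: (layer_hom_eq gH) => //; apply/phi_eq; rewrite ?phiX.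
have ex g : exists v : {ffun 'I_m -> 'Hom(F j, F i)}, layer_hom W i j g ->
    forall l u, v l u = psi (g (X (free_gen (F i) l u))).
  have [gH|ng] := EM (layer_hom W i j g); last by exists 0.
  have [gL g0] := gH.
  have vL l : linear (fun u => psi (g (X (free_gen (F i) l u)))).
    move=> c u u'; rewrite free_gen_linear.
    rewrite -(coordZ Ni nzy psiE) -(coordD Ni nzy psiE) -gL //; congr psi.
    apply/esym/gX => //; first apply: memvD => //.
      by case: (layer_mul c%:A (XL (free_gen (F i) l u))).
    by rewrite mulr_algl linearP /= !phiX.
  by exists [ffun l => linfun (lin (vL l))] => _ l u; rewrite ffunE lfunE.
have [Psi PsiE] := choice ex.
have P g : layer_hom W i j g -> forall l u x, x \in L ->
    phi x = free_gen (F i) l u -> Psi g l u = psi (g x).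
  by move=> gH l u x xL xE; rewrite PsiE // (gX g x _ gH xL xE).
exists Psi; split=> //.
- move=> v; have [phi' psiK phiK] := psiB.
  pose g x := phi' (free_ext v (phi x)).
  have gH : layer_hom W i j g.
    split=> [a x x' xL x'L|x x2]; apply: (can_inj psiK); rewrite /g phiK.
      rewrite linearD /= phi_mull // (coordD Ni nzy psiE).
      rewrite (coord_scale Ni nzy psiE) !phiK -free_ext_lact.
      by rewrite -[free_ext v _]/(lin (free_ext_linear v) _) linearD.
    rewrite phi_rad2 // (coord0 Ni nzy psiE).
    exact: (linear0 (lin (free_ext_linear v))).
  exists g => //; apply/ffunP=> l; apply/lfunP=> u.
  by rewrite (P g gH l u (X (free_gen (F i) l u))) // /g phiK phiX free_ext_gen.
- move=> g gH; split=> [g0|P0].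
    apply/ffunP=> l; apply/lfunP=> u.
    by rewrite PsiE // g0 // (coord0 Ni nzy psiE) ffunE lfunE.
  have gen0 l u : g (X (free_gen (F i) l u)) = 0.
    by apply/(coord_eq0 Ni nzy psiE psiB); rewrite -PsiE // P0 ffunE lfunE.
  have [gL gr] := gH; move=> x xL; rewrite (gX g x _ gH xL (erefl _)).
  rewrite [phi x]free_gen_span.
  have g0D z z' : g (X z) = 0 -> g (X z') = 0 -> g (X (z + z')) = 0.
    move=> gz gz'; rewrite -(gX g (1 * X z + X z') _ gH).
    + by rewrite gL // gz gz' scaler0 addr0.
    + by rewrite mul1r memvD.
    + by rewrite mul1r linearD /= !phiX.
  have g00 : g (X 0) = 0.
    by rewrite -(gX g 0 0 gH) ?gr ?mem0v ?linear0.
  apply: (big_ind (fun z => g (X z) = 0)) => // l _.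
  apply: (big_ind (fun z => g (X z) = 0)) => // q _.
  have [a aE] := proj_blk_ex (tensor_coef (phi x l) q).
  set z := free_gen _ _ _; rewrite -aE -(gX g (a * X z) _ gH).
  + by rewrite -[a * _]addr0 gL ?mem0v // gen0 gr ?mem0v // scaler0 addr0.
  + by case: (layer_mul a (XL z)).
  + by rewrite phi_mull // phiX.
Qed.
End Coord.
End LayerCoord.

(** * Endomorphisms and extensions computed through the basic algebra *)

Section BasicDimensions.
Variables (k : fieldType) (A B : falgType k).
Variables (F : klin_functor A B) (G : klin_functor B A).
Variables (eta : unit_iso F G) (eps : unit_iso G F).
Variables (s : nat) (W : top_dec B s) (basW : basic_alg W).

Lemma dim_subvs_gt0 (C : {aspace (top W)}) : (0 < \dim {:subvs_of C})%N.
Proof. exact: adim_gt0. Qed.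

Lemma dim_End_basic i (M : lmodType A) (SM : lmodType B) (sM : {linear F M -> SM}) :
  bijective sM -> simple_at W i SM -> dim_End M = \dim {:subvs_of (blk W i)}.
Proof.
move=> sMB Si; have [x0 nzx0] := proj1 (proj1 Si).
have [psi [psiE psiB]] := basic_coord basW Si nzx0.
have [th [thE thB]] := end_transport eta eps sMB.
have [t [tK sK]] := bij_lin_inv sMB.
(* Functors need bundled maps; nonlinear functions get [idfun] as a dummy. *)
have ex (f : M -> M) : exists d : {linear M -> M}, linear f -> d =1 f.
  by have [fL|nf] := EM (linear f); [exists (lin fL) | exists idfun].
have [d dE] := choice ex.
pose Phi f := end_coord x0 psi (th (d f)).
have PhiE f : Phi f = psi (sM (fmap F (d f) (t x0))).
  by rewrite /Phi /end_coord -{1}[x0]sK thE.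
have PhiI f g : linear f -> linear g -> Phi f = Phi g -> f = g.
  move=> fL gL /(bij_inj (end_coord_bij Si nzx0 psiE psiB))/(bij_inj thB) fg.
  by apply/funext=> x; rewrite -(dE f) // -(dE g) // fg.
have PhiL (c : k) f g h : linear f -> linear g -> linear h ->
    (forall x, h x = c%:A *: f x + g x) -> Phi h = c *: Phi f + Phi g.
  move=> fL gL hL hE; rewrite !PhiE.
  rewrite (fmap_linear (c := c) (f := d f) (g := d g)); last first.
    by move=> x; rewrite !dE.
  rewrite linearD linear_algZ (coordD Si nzx0 psiE).
  by rewrite (coordZ Si nzx0 psiE).
have L0 : linear (0 : M -> M).
  by move=> a x y; rewrite -[LHS]/(0 : M) -[_ + _]/(a *: 0 + 0 : M) scaler0 addr0.
have Phi0 : Phi 0 = 0.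
  rewrite (PhiL (-1) 0 0 0 L0 L0 L0) => [|x]; first by rewrite scaleN1r addNr.
  by rewrite -[LHS]/(0 : M) scaler0 add0r.
rewrite -[LHS]muln1 -(dim_regular k).
apply: (@dimensionE k k^o _ (fun c v => (c : k) *: v) *%R _ _ _ _ _
  (M -> M) (fun f => linear f) (fun f => f = 0) k _ Phi id).
- by rewrite dim_regular.
- by move=> v a b e; rewrite scalerDl scalerA.
- by move=> a u v; rewrite scalerBr.
- by move=> a b v; rewrite scalerA.
- by move=> a nza; exists a^-1 => v; rewrite scalerA mulVf ?scale1r.
- exact: lin_subr.
- move=> f g fL gL; rewrite (PhiL (-1) g f) //; last first.
  + by move=> x; rewrite !scaleN1r addrC.
  + exact: lin_subr.
  by rewrite scaleN1r addrC.
- move=> v; have [e' _ eK] := end_coord_bij Si nzx0 psiE psiB.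
  have [th' _ thK] := thB; exists (th' (e' v) : M -> M).
  have fL : linear (th' (e' v)) by move=> a x y; rewrite linearP.
  split=> //; rewrite /Phi (_ : d _ = th' (e' v)) ?thK ?eK //.
  by apply: linear_ext => x; rewrite dE.
- move=> f fL; split=> [->|f0]; first exact: Phi0.
  by apply: PhiI => //; rewrite f0 Phi0.
- by move=> a f fL; exists (fun x => a%:A *: f x).
- move=> a f g fL gE; have gL : linear g.
    move=> b x y; rewrite !gE fL scalerDr !scalerA; congr (_ *: _ + _).
    by rewrite mulr_algl mulr_algr.
  split=> //; rewrite (PhiL a f 0) ?Phi0 ?addr0 // => x.
  by rewrite gE -[(0 : M -> M) x]/(0 : M) addr0.
- by exists id.
Qed.

Variables (i j : 'I_s) (m : nat).
Variables (M N : lmodType A) (P : proj_resolution M) (SM SN : lmodType B).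
Variables (sM : {linear F M -> SM}) (sN : {linear F N -> SN}).
Hypotheses (simM : simple_mod M) (Sj : simple_at W j SM) (Si : simple_at W i SN).
Hypotheses (sMB : bijective sM) (sNB : bijective sN).

Lemma Ext1_neq0P (x0 : SM) : x0 != 0 ->
  Ext1_neq0 N P <->
  exists h : B -> SN, ann_linear x0 h /\ ~ ann_cob x0 h.
Proof.
move=> nzx0; have [Phi [PhiL _ Phic Phis _]] :=
  ext_transport eta eps P simM (proj1 Sj) sMB sNB nzx0.
split=> [[f [fC nf]]|[h [hL nh]]].
  by exists (Phi f); split; [apply: PhiL | move/(Phic f fC)].
have [f [fC [y yE]]] := Phis h hL; exists f; split=> // /(Phic f fC)[y' y'E].
apply: nh; exists (y' - y) => b bx; rewrite scalerBr -yE // -y'E //.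
by rewrite subKr.
Qed.

Hypothesis freeL : layer_free W i j m.

(** Psi after Phi identifies Ext^1 with [m] copies of Hom_k(F_j, F_i). Dividing the dimension over
    [k] by that of F_i or F_j gives the two values. *)
Lemma dim_Ext1_basic :
  dim_Ext1_l N P = (m * \dim {:subvs_of (blk W j)})%N /\
  dim_Ext1_r N P = (m * \dim {:subvs_of (blk W i)})%N.
Proof.
have [phi [phi_onto phi_ker phi_act]] := freeL.
have [x0 nzx0] := proj1 (proj1 Sj); have [y0 nzy0] := proj1 (proj1 Si).
have [psiM [psiME psiMB]] := basic_coord basW Sj nzx0.
have [psi [psiE psiB]] := basic_coord basW Si nzy0.
have [thM [thME thMB]] := end_transport eta eps sMB.
have [thN [thNE thNB]] := end_transport eta eps sNB.
have [Phi [PhiL PhiB Phic Phis [Phil Phir]]] :=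
  ext_transport eta eps P simM (proj1 Sj) sMB sNB nzx0.
have [Psi [PsiE Psis Psic]] :=
  layer_coord phi_onto phi_ker phi_act Si nzy0 psiE psiB.
have gen l u : exists2 x, x \in layer W i j &
    phi x = free_gen (subvs_of (blk W i)) l u.
  by have [x [? ?]] := phi_ex phi_onto (free_gen _ l u); exists x.
have hom f : cocycle1 f -> layer_hom W i j (Phi f).
  by move/PhiL/(ann_linear_layer Sj Si).
have ann0 x : x \in layer W i j -> x *: x0 = 0.
  by move/layer_rad/(rad_ann Sj).
have cob0 (h : B -> SN) x : ann_cob x0 h -> x \in layer W i j -> h x = 0.
  by move=> hc /layer_rad; apply: (ann_cob_layer Sj Si hc).
have [e eE] := topi_ex (blk1 W i); have [c cE] := topi_ex (blk1 W j).
have cj : topi W c \in blk W j by rewrite cE blk1_in.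
have cx : c *: x0 = x0 by apply: (simple_at1 _ Sj cE).
have cr a : a *: x0 = 0 -> a * c \in rad W.
  move/(basic_ann basW a Sj nzx0)/proj_blk_eq0 => a0.
  by rewrite mem_rad topiM cE a0.
pose V := {ffun 'I_m -> 'Hom(subvs_of (blk W j), subvs_of (blk W i))}.
have dimV : \dim {:V} =
    (m * (\dim {:subvs_of (blk W j)} * \dim {:subvs_of (blk W i)}))%N.
  by rewrite ffun_dim !dimvf.
(* A layer morphism [g] is extended to the annihilator as a |-> g(e.a.c.c), which agrees with [g] on
   the layer because block units act trivially modulo [r * r]. *)
have onto v : exists f, cocycle1 f /\ Psi (Phi f) = v.
  have [g gH gv] := Psis v.
  have [f [fC fh]] := Phis _ (layer_hom_ann cr gH eE cj).
  exists f; split=> //; rewrite -gv; apply/ffunP=> l; apply/lfunP=> u.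
  have [x xL xE] := gen l u.
  rewrite (PsiE _ (hom f fC) l u x) // (PsiE g gH l u x) //; congr psi.
  have /eqP := cob0 _ x fh xL; rewrite subr_eq0 => /eqP ->.
  have [ex _] := layer_fixed eE cE xL; have [exL _] := layer_mul e xL.
  have [_ exc] := layer_fixed eE cE exL; have [_ excL] := layer_mul c exL.
  have [_ excc] := layer_fixed eE cE excL.
  apply: (layer_hom_eq gH) => //; rewrite mulrA.
  rewrite -(subrK (e * x * c) (_ * c)) -addrA memvD //.
  by rewrite -(subrK (e * x) (_ * c)) -addrA memvD.
have PsiB f g : cocycle1 f -> cocycle1 g ->
    Psi (Phi (f - g)) = Psi (Phi f) - Psi (Phi g).
  move=> fC gC; have fgC := cocycle1B fC gC.
  apply/ffunP=> l; apply/lfunP=> u; have [x xL xE] := gen l u.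
  rewrite !ffunE add_lfunE opp_lfunE !(PsiE _ (hom _ _) l u x) // PhiB ?ann0 //.
  exact: (coordB Si nzy0 psiE).
have Psi0 f : cocycle1 f -> coboundary1 f <-> Psi (Phi f) = 0.
  move=> fC; split=> [/(Phic f fC) fc|/(Psic _ (hom f fC)) f0].
    by apply/(Psic _ (hom f fC)) => x; apply: cob0.
  by apply/(Phic f fC); apply: (ann_cobP Sj Si cj cx cr (PhiL f fC)).
have unit_ (i0 : 'I_s) (a : subvs_of (blk W i0)) : a != 0 -> a \is a GRing.unit.
  exact: basW.
(* Endomorphisms are right multiplications: those of SN act on values, those of SM on arguments.
   Hence the scalars compose by the opposite product for [actl] and by the ordinary one for
   [actr]. *)
pose actl a (v : V) : V := [ffun l => (amulr a \o v l)%VF].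
pose actr a (v : V) : V := [ffun l => (v l \o amulr a)%VF].
have actlE a v l u : actl a v l u = v l u * a.
  by rewrite ffunE comp_lfunE lfunE.
have actrE a v l u : actr a v l u = v l (u * a).
  by rewrite ffunE comp_lfunE lfunE.
have VL (a : k) (v v' : V) l u : (a *: v + v') l u = a *: v l u + v' l u.
  by rewrite !ffunE add_lfunE scale_lfunE.
have VB (v v' : V) l u : (v - v') l u = v l u - v' l u.
  by rewrite !ffunE add_lfunE opp_lfunE.
have eqV (v v' : V) : (forall l u, v l u = v' l u) -> v = v'.
  by move=> vv'; apply/ffunP=> l; apply/lfunP=> u.
split.
  apply/eqP; rewrite -(eqn_pmul2r (dim_subvs_gt0 (blk W i))) -mulnA -dimV.
  apply/eqP; apply: (@dimensionE k (subvs_of (blk W i)) V actl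
    (fun a b => b * a) _ _ _ _ _ _ _ _ _ _ (Psi \o Phi)
    (end_coord y0 psi \o thN)) => //.
  - exact: dim_subvs_gt0.
  - move=> v a b b'; apply: eqV => l u.
    by rewrite VL !actlE mulrDr scalerAr.
  - by move=> a v v'; apply: eqV => l u; rewrite VB !actlE VB mulrBl.
  - by move=> a b v; apply: eqV => l u; rewrite !actlE mulrA.
  - move=> a /unit_ ua; exists a^-1 => v; apply: eqV => l u.
    by rewrite !actlE mulrK.
  - by move=> f g; apply: cocycle1B.
  - by move=> d f _; apply: Ext1_lact_ex.
  - move=> d f g fC gE; have gC := Ext1_lact_cocycle fC gE; split=> //.
    apply: eqV => l u; have [x xL xE] := gen l u.
    rewrite actlE /= !(PsiE _ (hom _ _) l u x) //.
    rewrite (Phil _ thNE d f g) ?ann0 //.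
    exact: (end_coordE Si nzy0 psiE).
  - apply: bij_comp => //; exact: (end_coord_bij Si nzy0 psiE psiB).
apply/eqP; rewrite -(eqn_pmul2r (dim_subvs_gt0 (blk W j))) -mulnA.
rewrite [(\dim {:subvs_of (blk W i)} * _)%N]mulnC -dimV.
apply/eqP; apply: (@dimensionE k (subvs_of (blk W j)) V actr
  (fun a b => a * b) _ _ _ _ _ _ _ _ _ _ (Psi \o Phi)
  (end_coord x0 psiM \o thM)) => //.
- exact: dim_subvs_gt0.
- move=> v a b b'; apply: eqV => l u.
  by rewrite VL !actrE mulrDr -scalerAr linearP.
- by move=> a v v'; apply: eqV => l u; rewrite VB !actrE VB.
- by move=> a b v; apply: eqV => l u; rewrite !actrE mulrA.
- move=> a /unit_ ua; exists a^-1 => v; apply: eqV => l u.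
  by rewrite !actrE mulrVK.
- by move=> f g; apply: cocycle1B.
- by move=> d f _; apply: Ext1_ract_ex.
- move=> d f g fC gR; have gC := Ext1_ract_cocycle fC gR; split=> //.
  (* Up to a coboundary, which vanishes on the layer, [d] acts by right multiplication of the
     argument by [b]; under [phi] this is right multiplication by the multiplier of [d]. *)
  have [b bE] := simple_gen (proj1 Sj) nzx0 (thM d x0).
  apply: eqV => l u; have [x xL xE] := gen l u.
  have [_ xbL] := layer_mul b xL.
  rewrite actrE /= (PsiE _ (hom _ gC) l u x) //.
  rewrite (PsiE _ (hom _ fC) l _ (x * b)) //.
    congr psi; have := cob0 _ x (Phir _ thME d f g b fC gR (esym bE)) xL.
    by move/eqP; rewrite subr_eq0 => /eqP.
  rewrite (phi_mulr phi_ker phi_act) // xE free_gen_ract; congr free_gen.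
  by congr (_ * _); rewrite /end_coord bE psiME.
- apply: bij_comp => //; exact: (end_coord_bij Sj nzx0 psiME psiMB).
Qed.
End BasicDimensions.

(** * Ranks, arrows and the theorem *)

Section FreeRank.
Variables (k : fieldType) (R S : falgType k) (t : nat).
Local Notation e := (vbasis {:R}).
Local Notation f := (vbasis {:S}).

Lemma dim_alg_gt0 (C : falgType k) : (0 < \dim {:C})%N.
Proof. exact: (adim_gt0 (aspacef C)). Qed.

Lemma dim_free_bimod :
  \dim {: {ffun 'I_t -> 'M[k]_(\dim {:R}, \dim {:S})}} =
  (t * (\dim {:R} * \dim {:S}))%N.
Proof. by rewrite ffun_dim dimvf. Qed.

Lemma tens_spanr (z : tensor R S) :
  z = \sum_(p < \dim {:R}) tens e`_p (vecof f (row p z)).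
Proof.
apply/matrixP=> p q; rewrite summxE (bigD1 p) //= big1 => [|p' np].
  by rewrite /tens rVofE ?vbasisP // vecofK ?vbasisP // mxE big_ord1 !mxE
    !eqxx mul1r addr0.
by rewrite /tens rVofE ?vbasisP // mxE big_ord1 !mxE [p == _]eq_sym (negPf np)
  andbF mul0r.
Qed.

(** The 1 (x) f_q in each copy generate. Conversely [n] generators span at most n.dim R dimensions
    over [k], and t.dim R.dim S are required. *)
Lemma free_rank_lE : free_rank_l R S t = (t * \dim {:S})%N.
Proof.
apply: least_eq => [|n [y gen]].
  have cI : #|{: 'I_t * 'I_(\dim {:S})}| = (t * \dim {:S})%N.
    by rewrite card_prod !card_ord.
  rewrite -cI; exists (fun l : 'I_#|{: 'I_t * 'I_(\dim {:S})}| =>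
    free_gen R (enum_val l).1 f`_(enum_val l).2) => z.
  exists (fun l => tensor_coef (z (enum_val l).1) (enum_val l).2).
  rewrite [LHS]free_gen_span pair_big /=.
  by rewrite (reindex _ (onW_bij _ (enum_val_bij _))).
rewrite -(leq_pmul2r (dim_alg_gt0 R)) -mulnA [(\dim {:S} * _)%N]mulnC.
rewrite -dim_free_bimod.
apply: (@span_family_dim _ _ _ _ (fun l c => free_lact c (y l))) => // l c a b.
apply/ffunP=> l'; rewrite !ffunE /tensor_lact.
by rewrite !linearP /= mulmxDl -scalemxAl.
Qed.

Lemma free_rank_rE : free_rank_r R S t = (t * \dim {:R})%N.
Proof.
apply: least_eq => [|n [y gen]].
  have cI : #|{: 'I_t * 'I_(\dim {:R})}| = (t * \dim {:R})%N.
    by rewrite card_prod !card_ord.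
  pose gen (l : 'I_t) (p : 'I_(\dim {:R})) : free_bimod R S t :=
    [ffun l' => if l' == l then tens e`_p 1 else 0].
  have span (z : free_bimod R S t) :
      z = \sum_l \sum_p free_ract (gen l p) (vecof f (row p (z l))).
    apply/ffunP=> l; rewrite sum_ffunE (bigD1 l) //= [X in _ + X]big1 => [|l' nl].
      rewrite addr0 sum_ffunE [LHS]tens_spanr; apply: eq_bigr => p _.
      by rewrite !ffunE eqxx tensor_ract_tens mul1r.
    rewrite sum_ffunE big1 // => p _; rewrite !ffunE [l == _]eq_sym (negPf nl).
    exact: (linear0 (lin (tensor_ract_linear _))).
  rewrite -cI; exists (fun l : 'I_#|{: 'I_t * 'I_(\dim {:R})}| =>
    gen (enum_val l).1 (enum_val l).2) => z.
  exists (fun l => vecof f (row (enum_val l).2 (z (enum_val l).1))).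
  rewrite [LHS]span pair_big /=.
  by rewrite (reindex _ (onW_bij _ (enum_val_bij _))).
rewrite -(leq_pmul2r (dim_alg_gt0 S)) -mulnA -dim_free_bimod.
apply: (@span_family_dim _ _ _ _ (fun l c => free_ract (y l) c)) => // l c a b.
apply/ffunP=> l'; rewrite !ffunE /tensor_ract.
by rewrite !linearP.
Qed.

Lemma free_bimod_neq0 : (exists z : free_bimod R S t, z != 0) <-> (0 < t)%N.
Proof.
split=> [[z]|t_gt0].
  apply: contraNltn; rewrite leqn0 => /eqP t0; apply/eqP/ffunP=> l.
  by have := leq_trans (ltn_ord l) (eq_leq t0).
exists [ffun=> const_mx 1]; apply/eqP=> /ffunP/(_ (Ordinal t_gt0)).
rewrite !ffunE => /matrixP.
move/(_ (Ordinal (dim_alg_gt0 R)) (Ordinal (dim_alg_gt0 S)))/eqP.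
by rewrite !mxE oner_eq0.
Qed.
End FreeRank.

(** The value 0 of [least] could also mean that no finite family generates. A basis of the layer
    does generate, so 0 means that the empty family does. *)
Lemma arrows_gt0 (k : fieldType) (A : falgType k) (s : nat) (W : top_dec A s)
    (i j : 'I_s) :
  (0 < arrows W i j)%N <-> layer W i j != (rad W * rad W)%VS.
Proof.
set L := layer W i j; set r := rad W.
pose P n := exists x : 'I_n -> A, (forall l, x l \in L) /\
  (\sum_(l < n) blk_pre W i * <[x l]> * blk_pre W j + r * r)%VS = L.
have P0 : P 0%N <-> L = (r * r)%VS.
  split=> [[x [_ <-]]|Lr]; first by rewrite big_ord0 add0v.
  by exists (fun=> 0); split=> [[]//|]; rewrite big_ord0 add0v.
have [e eE] := topi_ex (blk1 W i); have [b bE] := topi_ex (blk1 W j).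
have Pd : P (\dim L).
  exists (fun l => (vbasis L)`_l).
  have xL (l : 'I_(\dim L)) : (vbasis L)`_l \in L.
    by apply: vbasis_mem; rewrite mem_nth // size_tuple.
  split=> //; apply/eqP; rewrite eqEsubv subv_add; apply/andP; split.
    apply/andP; split; last exact: addvSr.
    apply/subv_sumP=> l _; apply: subv_trans (_ : L * fullv <= L)%VS.
      apply: prodvS (subvf _); apply/prodvP=> a _ _ /vlineP[c ->].
      by rewrite -scalerAr memvZ //; case: (layer_mul a (xL l)).
    by apply/prodvP=> x a xL' _; case: (layer_mul a xL').
  rewrite -{1}(span_basis (vbasisP L)); apply/span_subvP=> x.
  move=> /(nthP 0)[l]; rewrite size_tuple => lt_l <-.
  have xl := xL (Ordinal lt_l); rewrite /= in xl; set x' := _`_l in xl *.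
  have [ex _] := layer_fixed eE bE xl; have [exL _] := layer_mul e xl.
  have [_ exb] := layer_fixed eE bE exL.
  (* Modulo [r * r] each basis vector equals its product with lifts of the two block units. *)
  rewrite (_ : x' = e * x' * b + - (e * x' * b - e * x' + (e * x' - x'))).
    apply: memv_add; last by rewrite memvN memvD.
    apply: (subvP (sumv_sup (Ordinal lt_l) _ (subvv _))) => //=.
    by rewrite !memv_mul ?memv_line ?mem_blk_pre ?eE ?bE ?blk1_in.
  by rewrite addrA subrK subKr.
have [Pl lel] := leastP Pd; rewrite -/(arrows W i j) in Pl lel.
rewrite lt0n; split.
  by apply: contraNneq => Lr; rewrite -leqn0; apply/lel/P0.
by apply: contraNneq => t0; apply/eqP; move: Pl; rewrite t0 => /P0.
Qed.

Section Identity.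
Variables (k : fieldType) (A : falgType k).

(** With the identity equivalence, the comparison of presentations applies over A itself, for an
    arbitrary resolution. *)
Definition id_functor : klin_functor A A :=
  @KlinFunctor k A A (fun M => M) (fun M N f => f) (fun M x => erefl)
    (fun L M N g f x => erefl) (fun M N c f g h hE => hE).

Definition id_unit : unit_iso id_functor id_functor.
Proof.
by exists (fun M : lmodType A => idfun : {linear M -> M}) => // M; exists idfun.
Defined.
End Identity.

Theorem theorem7p5 (k : fieldType) (A B : falgType k) (s : nat)
  (WA : top_dec A s) (WB : top_dec B s)
  (T : 'I_s -> lmodType A) (S : 'I_s -> lmodType B)
  (hT : forall i, simple_at WA i (T i))
  (hS : forall i, simple_at WB i (S i))
  (hB : basic_alg WB)
  (F : morita_equiv A B)
  (hF : forall i, mod_iso (F (T i)) (S i))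
  (P : forall j, proj_resolution (T j)) :
  let Delta := natural_valued_quiver WA in
  let Q := valued_Ext_quiver P in
  let n (i : 'I_s) : rat := (dim_mod (T i))%:R / (dim_End (T i))%:R in
  let t (i j : 'I_s) : nat := arrows WA i j in
  let m (i j : 'I_s) : nat := arrows WB i j in
  [/\ vertex Delta = vertex Q /\
      (forall M : lmodType A, simple_mod M -> exists! i : 'I_s, mod_iso M (T i)),
      forall i j : 'I_s, @edge Delta i j <-> @edge Q i j
    & forall i j : 'I_s, @edge Delta i j -> layer_free WB i j (m i j) ->
      let d := @valuation Delta i j in
      let e := @valuation Q i j in
      d.2%:R = e.1%:R * n j ^+ 2 * ((t i j)%:R / (m i j)%:R) :> rat /\
      d.1%:R = e.2%:R * n i ^+ 2 * ((t i j)%:R / (m i j)%:R) :> rat].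
Proof.
move=> Delta Q n t m.
have simT i : simple_mod (T i) by case: (hT i).
have idB (M : lmodType A) : bijective (idfun : {linear M -> M}) by exists idfun.
have edgeD i j : @edge Delta i j <-> (0 < t i j)%N by apply: free_bimod_neq0.
have edgeQ i j : @edge Delta i j <-> @edge Q i j.
  have [x0 nzx0 extL] := ext_layer (hT j) (hT i).
  rewrite edgeD arrows_gt0 -extL.
  exact: iff_sym (Ext1_neq0P (id_unit A) (id_unit A) (P j) (simT j) (hT j)
    (idB (T j)) (idB (T i)) nzx0).
split=> //.
  split=> // M simM; have [i Mi] := simple_at_ex WA simM; exists i; split.
    exact: simple_at_iso Mi (hT i).
  move=> j /(simple_at_mod_iso simM)/(_ (hT j)) Mj; exact: simple_at_inj Mi Mj.
move=> i j ij freeL d e.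
have [sM sMB] := hF j; have [sN sNB] := hF i.
have [eta eps] := (morita_unit F, morita_counit F).
have [el er] := dim_Ext1_basic eta eps hB (P j) (simT j) (hS j) (hS i)
  sMB sNB freeL.
have dimE l : dim_End (T l) = \dim {:subvs_of (blk WB l)}.
  by have [f fB] := hF l; apply: (dim_End_basic eta eps hB fB (hS l)).
have dimE_gt0 l : (0 < dim_End (T l))%N by rewrite dimE dim_subvs_gt0.
have dimA l : (\dim {:subvs_of (blk WA l)} * dim_End (T l) = dim_mod (T l) ^ 2)%N.
  have [e0 ePI] := primitive_idem_ex WA l.
  by rewrite dim_subvs; apply: (dim_blk_simple ePI (hT l)).
(* The edge gives a nonzero Ext^1 over A; the equivalence carries it to B, where it forces a nonzero
   layer. *)
have m_gt0 : (0 < m i j)%N.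
  have [y0 nzy0 extL] := ext_layer (hS j) (hS i).
  apply/arrows_gt0/extL.
  apply/(Ext1_neq0P eta eps (P j) (simT j) (hS j) sMB sNB nzy0).
  exact/edgeQ.
(* Both formulas at once: [y], [p] and [q] stand for the dimensions over [k] of End(T_l), T_l and
   A_l, so that q/y is the square of n_l. *)
have val (y p q : nat) : (0 < y)%N -> (q * y = p ^ 2)%N ->
    (t i j * q)%:R = (m i j * y)%:R * (p%:R / y%:R) ^+ 2 *
      ((t i j)%:R / (m i j)%:R) :> rat.
  move=> y_gt0 qy; have y0 : y%:R != 0 :> rat by rewrite Num.Theory.pnatr_eq0 -lt0n.
  have m0 : (m i j)%:R != 0 :> rat by rewrite Num.Theory.pnatr_eq0 -lt0n.
  rewrite expr_div_n -natrX -qy !natrM; field.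
  by rewrite y0 m0.
split; rewrite /d /e /=.
  by rewrite free_rank_lE el -dimE; apply: val (dimA _).
by rewrite free_rank_rE er -dimE; apply: val (dimA _).
Qed.
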